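(* Let $\lambda>0$, $\mu\ge 0$ with $\lambda\neq\mu$, put $\rho=\mu/\lambda$ and $\delta=\lambda-\mu$, and let $t>0$ and $\sigma\in[0,1)$. Consider the constant rate birth and death process with birth rate $\lambda$ and death rate $\mu$ started with one lineage at time $0$, and let $M_{\sigma,t}$ be the number of lineages at time $\sigma t$ in the reconstructed tree at time $t$, so that $M_{1,t}$ is the number of species at time $t$. Then for every integer $n\ge 1$, $$\mathbb{E}[M_{\sigma,t}\mid M_{1,t}=n]=\frac{1+n f(\sigma,t,\rho,\delta)}{1+f(\sigma,t,\rho,\delta)},$$ where $$f(\sigma,t,\rho,\delta)=(1-\rho)\,\frac{(1-e^{-\sigma\delta t})\,e^{-(1-\sigma)\delta t}}{(1-e^{-(1-\sigma)\delta t})(1-\rho e^{-\delta t})}.$$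
   Context: Constant rate birth and death process: it starts at time $0$ (the origin of the tree) with a single lineage; independently, each lineage existing at a given time splits into two lineages at rate $\lambda$ and dies at rate $\mu$. The complete tree at time $t$ is the genealogical tree of all lineages up to time $t$, including those extinct by time $t$. The reconstructed tree at time $t$ is obtained from it by removing all lineages that have no descendants alive at time $t$. Thus, for $\sigma\in[0,1]$, $M_{\sigma,t}$ is the number of lineages alive at time $\sigma t$ which have at least one descendant (possibly the lineage itself) alive at time $t$; in particular $M_{1,t}$ is the number of lineages alive at time $t$ (''today''). *)

(* Defs.v *)
From HB Require Import structures.
From mathcomp Require Import all_boot all_order all_algebra.
From mathcomp Require Import all_classical all_reals all_analysis.
From mathcomp Require Import measurable_realfun.

Set Implicit Arguments.
Unset Strict Implicit.
Unset Printing Implicit Defensive.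

Import Order.TTheory GRing.Theory Num.Theory.
Import numFieldNormedType.Exports.

Local Open Scope classical_set_scope.
Local Open Scope ring_scope.
Local Open Scope ereal_scope.

(** Lineages are the nodes of the infinite binary tree: [[::]] is the lineage
    present at time 0 and [b :: u] (b : bool) are the two lineages into which
    [u] splits, so the ancestors of [u], itself included, are its suffixes. *)
Definition lineage := seq bool.

Section clocks.
Context {d : measure_display} {T : measurableType d} {R : realType}.
Variable P : probability T R.

(** Exponential waiting time of rate [r]. The rate 0 is allowed, in which case
    [X = +oo] almost surely; this is why clocks are extended-real-valued and
    why the law is given by its tail instead of by [exponential_prob]. *)
Definition exponential_clock (r : R) (X : T -> \bar R) : Prop :=
  forall x : R, (0 <= x)%R -> P [set w | x%:E < X w] = (expR (- r * x))%:E.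

Definition mutually_independent (I : choiceType) (X : I -> T -> \bar R) : Prop :=
  forall (s : seq I) (A : I -> set (\bar R)), uniq s ->
    (forall i, i \in s -> measurable (A i)) ->
    P (\bigcap_(i in [set` s]) X i @^-1` A i) =
    \prod_(i <- s) P (X i @^-1` A i).

(** [S u] and [D u] are the waiting times, counted from the birth of [u], until
    [u] would split, resp. die; whichever comes first takes place. *)
Definition birth_death_clocks (lambda mu : R)
    (S D : lineage -> {RV P >-> \bar R}) : Prop :=
  [/\ forall u, exponential_clock lambda (S u),
      forall u, exponential_clock mu (D u) &
      mutually_independent (fun i : lineage + lineage =>
        match i with inl u => S u : T -> \bar R | inr u => D u end)].

(** E[X | A] for an event A of positive probability. *)
Definition cond_expectation (X : T -> \bar R) (A : set T) : \bar R :=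
  (\int[P]_(w in A) X w) * ((fine (P A))^-1)%:E.

End clocks.

Section tree.
Context {T : Type} {R : realType}.
Variables S D : lineage -> T -> \bar R.

(** All the proper ancestors of [u] split before dying. *)
Fixpoint born (w : T) (u : lineage) : Prop :=
  if u is _ :: v then born w v /\ S v w < D v w else True.

(** Only meaningful when [born w u]. *)
Fixpoint birth_time (w : T) (u : lineage) : \bar R :=
  if u is _ :: v then birth_time w v + S v w else 0.

Definition alive (w : T) (s : R) (u : lineage) : Prop :=
  [/\ born w u, birth_time w u <= s%:E &
      s%:E < birth_time w u + mine (S u w) (D u w)].

(** M_{sigma,t}; [counting] is [+oo] on infinite sets. *)
Definition num_reconstructed (sigma t : R) (w : T) : \bar R :=
  counting [set u | alive w (sigma * t)%R u /\
                    exists v, suffix u v /\ alive w t v].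

End tree.

Definition f_reconstructed {R : realType} (sigma t rho delta : R) : R :=
  ((1 - rho) *
   (((1 - expR (- sigma * delta * t)) * expR (- (1 - sigma) * delta * t)) /
    ((1 - expR (- (1 - sigma) * delta * t)) * (1 - rho * expR (- delta * t)))))%R.

(* Main.v *)
(** Let [p_n s = P(N_s = n)] be the law of the population at time [s] and, for
    [tau > 0], [a_n s = E(M; N_(s + tau) = n)], where [M] counts the lineages at time [s]
    with descendants at time [s + tau]. Decomposing according to the first event of the
    root, and using that after a split at time [x] the two subtrees are independent
    processes driven by their own clocks, one gets the renewal equations
      [p_n s = [n=0] + ([n=1] - [n=0]) e^(-(lambda+mu)s)
         + int_0^s lambda e^(-(lambda+mu)x) (sum_j p_j p_(n-j) (s-x) - [n=0]) dx],
      [a_n s = p_n (s+tau) + int_0^s lambda e^(-(lambda+mu)x)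
         sum_j (a_j p_(n-j) + p_j a_(n-j) - p_j p_(n-j)) dx].
    With [E = e^(-(lambda-mu)s)] and [eta s = lambda (1-E) / (lambda - mu E)], they are solved
    by the modified geometric law of ratio [eta] and by
      [a_n s = p_n (s+tau) (1 + (n-1) (1 - eta tau / eta (s+tau)))],
    and [1 + f = eta t / eta (t - sigma t)].
    Uniqueness is a contraction argument: a bound on the distance to the solution that
    holds for every family of clocks on the given probability space holds in particular for
    the clocks of the two subtrees, hence is halved by the renewal equation. So no
    identity in law between a tree and its subtrees is ever needed. *)
Require Import Defs.
From HB Require Import structures.
From mathcomp Require Import all_boot all_order all_algebra.
From mathcomp Require Import finmap.
From mathcomp Require Import all_classical all_reals all_analysis.
From mathcomp Require Import measurable_realfun.
From mathcomp Require Import ring lra.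
Set Implicit Arguments.
Unset Strict Implicit.
Unset Printing Implicit Defensive.
Import Order.TTheory GRing.Theory Num.Theory.
Import numFieldNormedType.Exports.
Local Open Scope classical_set_scope.
Local Open Scope ring_scope.

(** * The counting measure *)

(** The equations for index n involve only indices j <= n, so for fixed n they form a finite closed
    system and no generating function is called for. Explosion is not excluded beforehand:
    populations may be +oo, but every expectation carries the indicator of N_t = n, and M <= N_t on
    each path with positive split clocks, so the unknowns are finite and bounded. The shape of [a_n]
    comes from the coalescent picture: given N_t = n, the n - 1 gaps between neighbouring living
    lineages have independent coalescence depths with distribution function eta(tau) / eta(t), and a
    gap adds a lineage to M exactly when its depth exceeds tau. Only the split clock of the root is
    integrated against a density. The death clock enters through its tail, so mu = 0, where it is
    almost surely infinite, is no separate case. The population law is settled first: its equation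
    is quadratic, but once it is known the equation for [a_n] is linear. *)

Lemma counting_ge0 {T : choiceType} {R : realType} (A : set T) :
  (0 <= counting A :> \bar R)%E.
Proof. by rewrite /counting; case: ifP; rewrite ?leey// lee_fin. Qed.

Lemma counting_card_le {R : realType} {T U : choiceType} (A : set T) (B : set U) :
  (A #<= B)%card -> (counting A <= counting B :> \bar R)%E.
Proof.
move=> AB; rewrite /counting; case: asboolP => [fA|iA]; case: asboolP => [fB|iB].
- rewrite lee_fin ler_nat; have /finite_setP[n An] := fA.
  rewrite (card_fset_set An) leq_card_fset_set//.
  by rewrite -(card_le_eql An).
- by rewrite leey.
- by exfalso; apply: iA; exact: card_le_finite fB.
- by [].
Qed.

Lemma counting_card_eq {R : realType} {T U : choiceType} (A : set T) (B : set U) :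
  (A #= B)%card -> counting A = counting B :> \bar R.
Proof.
rewrite card_eq_le => /andP[AB BA].
by apply/eqP; rewrite eq_le !counting_card_le.
Qed.

Lemma counting_image {R : realType} {T U : choiceType} (f : T -> U) (A : set T) :
  injective f -> counting (f @` A) = counting A :> \bar R.
Proof. by move=> fi; apply/counting_card_eq/inj_card_eq => x y _ _; exact: fi. Qed.

(** Via [pickle] the sets are moved into [nat], where [counting] is used as a measure. *)
Lemma counting_setU {R : realType} {T : countType} (A B : set T) :
  A `&` B = set0 -> counting (A `|` B) = (counting A + counting B)%E :> \bar R.
Proof.
move=> dAB.
have pI := pcan_inj (@choice.pickleK T).
rewrite -!(counting_image _ pI) image_setU.
rewrite -[LHS]/((@counting nat R : {measure set nat -> \bar R}) _) measureU//.
apply/seteqP; split => // _ [[x Ax <-] [y By /pI yx]].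
by have : (A `&` B) x; [split => //; rewrite -yx|rewrite dAB].
Qed.

(** Writing a cardinality as a series of indicators reduces the measurability of a random
    cardinality to that of countably many events. *)
Lemma counting_series {R : realType} {T : countType} (A : set T) :
  counting A = (\sum_(i <oo) (\1_(choice.pickle @` A) i)%:E)%E :> \bar R.
Proof.
have pI := pcan_inj (@choice.pickleK T).
rewrite -(counting_image _ pI).
set B := choice.pickle @` A.
have -> : B = \bigcup_i (B `&` [set i]).
  by rewrite -setI_bigcupr; apply/seteqP; split => [x Bx|x []//]; split => //; exists x.
rewrite -[LHS]/((@counting nat R : {measure set nat -> \bar R}) _) measure_bigcup//; last first.
  by apply/trivIsetP => i j _ _ ij; apply/seteqP; split => // x [[_ ->]] [_ /eqP]; exact/negP.
rewrite eseries_mkcond; apply: eq_eseriesr => i _; rewrite in_setT -setI_bigcupr.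

have -> : \bigcup_i [set i] = [set: nat] by apply/seteqP; split => // x _; exists x.
rewrite setIT indicE; have [iB|iB] := boolP (i \in B).
  rewrite (_ : _ `&` _ = [set i]) /= /counting ?asboolT ?fset_set1 ?cardfs1//.
  by apply/seteqP; split => [x []//|x ->]; split => //; exact: set_mem iB.
rewrite (_ : _ `&` _ = set0) /= /counting ?asboolT ?fset_set0//.
by apply/seteqP; split => // x [] /[swap] -> /mem_set; exact/negP.
Qed.

Lemma measurable_fun_counting {d} {T : measurableType d} {R : realType}
    {U : countType} (A : T -> set U) :
  (forall u, measurable [set w | A w u]) ->
  measurable_fun setT (fun w => counting (A w) : \bar R).
Proof.
move=> mA; rewrite (_ : (fun w => _) =
  fun w => (\sum_(i <oo) (\1_(choice.pickle @` (A w)) i)%:E)%E); last first.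
  by apply/funext => w; exact: counting_series.
apply: ge0_emeasurable_sum => [k x _ _|k _]; first by rewrite lee_fin.
apply/measurable_EFinP.
(* Term k is the indicator of the event of the element coded by k, and 0 if k is not a code.
   Decoding k to u does not make k the code of u, hence the second test. *)
case E : (choice.unpickle k : option U) => [u|].
  have [uk|uk] := eqVneq (choice.pickle u) k.
    rewrite (_ : (fun w => _) = \1_[set w | A w u]); first exact: measurable_indic.
    apply/funext => w; rewrite !indicE; congr (nat_of_bool _)%:R.
    apply/idP/idP => /set_mem.
      by move=> [v Av vk]; apply/mem_set; move: E; rewrite -vk choice.pickleK => -[<-].
    by move=> Au; apply/mem_set; exists u.
  rewrite (_ : (fun w => _) = cst 0) //; apply/funext => w; rewrite indicE.
  rewrite memNset// => -[v Av vk]; move: E; rewrite -vk choice.pickleK => -[vu].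
  by move: uk; rewrite -vu vk eqxx.
rewrite (_ : (fun w => _) = cst 0) //; apply/funext => w; rewrite indicE.
by rewrite memNset// => -[v Av vk]; move: E; rewrite -vk choice.pickleK.
Qed.

(** * Trees of lineages *)

(** Absolute times replace the fraction sigma: seen from a subtree born at x they become s - x and t
    - x, whose ratio is no longer sigma but whose difference is unchanged. *)
Definition recon {T : Type} {R : realType} (S D : lineage -> T -> \bar R)
    (s t : R) (w : T) : \bar R :=
  counting [set u | alive S D w s u /\ exists v, suffix u v /\ alive S D w t v].

(** Ancestors are suffixes, so the first branching is recorded by the last letter: the descendants
    of the child b of the root are the lists [rcons v b]. *)
Definition subtree {T : Type} (b : bool) (X : lineage -> T) : lineage -> T :=
  fun v => X (rcons v b).

Section paths.
Local Open Scope ereal_scope.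
Context {T : Type} {R : realType}.
Implicit Types (S D : lineage -> T -> \bar R) (w : T) (u v : lineage) (s t x : R).

Lemma born_rcons S D w v b : born S D w (rcons v b) <->
  born (subtree b S) (subtree b D) w v /\ S [::] w < D [::] w.
Proof.
elim: v => [|a v IH] //=.
by rewrite IH /subtree; tauto.
Qed.

Lemma birth_time_rcons S w v b :
  birth_time S w (rcons v b) = S [::] w + birth_time (subtree b S) w v.
Proof.
by elim: v => [|a v IH] /=; rewrite ?add0e ?adde0// IH addeA.
Qed.

Lemma alive_nil S D w s :
  alive S D w s [::] <-> (0 <= s)%R /\ s%:E < mine (S [::] w) (D [::] w).
Proof. by rewrite /alive /= add0e lee_fin; split => [[]|[]]. Qed.

Lemma alive_rcons S D w s x v b : S [::] w = x%:E ->
  alive S D w s (rcons v b) <->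
  x%:E < D [::] w /\ alive (subtree b S) (subtree b D) w (s - x)%R v.
Proof.
move=> Sx; rewrite /alive birth_time_rcons Sx -addeA !EFinB leeBrDl// lteBlDl//.
by split => [[/born_rcons[? +] ? ?]|[? [? ? ?]]]; rewrite ?Sx//; split => //; apply/born_rcons; rewrite Sx.
Qed.

Lemma recon_dead S D w s t : D [::] w <= S [::] w -> D [::] w <= s%:E ->
  recon S D s t w = 0.
Proof.
move=> DS Ds; rewrite /recon (_ : [set _ | _] = set0).
  by rewrite /counting asboolT ?fset_set0.
apply/seteqP; split => // u [+ _]; case/lastP: u => [|v b].
  by move=> /alive_nil[_]; rewrite lt_min => /andP[_]; rewrite ltNge Ds.
by move=> [/born_rcons[_]]; rewrite ltNge DS.
Qed.

(** At a time s >= x the root is gone, so every counted lineage ends in a letter b, which tells the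
    subtree it belongs to. *)
Lemma recon_split S D w s t x : S [::] w = x%:E -> x%:E < D [::] w -> (x <= s)%R ->
  recon S D s t w =
  recon (subtree false S) (subtree false D) (s - x) (t - x) w +
  recon (subtree true S) (subtree true D) (s - x) (t - x) w.
Proof.
move=> Sx xD xs; rewrite /recon.
pose A b : set lineage := [set u | alive (subtree b S) (subtree b D) w (s - x)%R u /\
   exists v, suffix u v /\ alive (subtree b S) (subtree b D) w (t - x)%R v].
have rI b : injective (fun v : lineage => rcons v b) by move=> u v /rcons_inj[].
rewrite -(counting_image (A false) (rI false)) -(counting_image (A true) (rI true)).
rewrite -counting_setU; last first.
  by apply/seteqP; split => // u [[v _ <-] [v' _ /rcons_inj[]]].
congr counting; apply/seteqP; split => [u []|u].
  case/lastP: u => [|u b].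
    by move=> /alive_nil[_]; rewrite Sx lt_min lte_fin => /andP[sx _]; move: xs; rewrite leNgt sx.
  move=> /(alive_rcons _ _ _ _ Sx)[_ au] [v [uv av]].
  suff : ((rcons ^~ b) @` A b) (rcons u b) by case: b {au uv} => ?; [right|left].
  exists u => //; split => //.
  (* The living descendant ends in the same letter as its ancestor, so it is a witness inside the
     same subtree. *)
  case/lastP: v => [|v b'] in uv av *.
    by move: uv; rewrite suffixs0 => /eqP; case: u {au}.
  move: uv; rewrite suffix_rcons => /andP[/eqP bb' uv].
  by move: av => /(alive_rcons _ _ _ _ Sx)[_]; rewrite -bb'; exists v.
suff H b : ((rcons ^~ b) @` A b) u -> alive S D w s u /\
    exists v, suffix u v /\ alive S D w t v by case => /H.
move=> [v [av [v' [vv' av']]] <-]; split; first exact/(alive_rcons _ _ _ _ Sx).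
by exists (rcons v' b); rewrite suffix_rcons eqxx; split => //; exact/(alive_rcons _ _ _ _ Sx).
Qed.

Lemma birth_time_ge0 S w u : (forall v, 0 < S v w) -> 0 <= birth_time S w u.
Proof. by move=> Spos; elim: u => [|b u IH] //=; rewrite adde_ge0// ltW. Qed.

Section positive_clocks.
Context (S D : lineage -> T -> \bar R) (w : T).
Hypothesis Spos : forall u, 0 < S u w.

(** A proper descendant of [u] is born at the split of [u] at the earliest. *)
Lemma birth_time_cat b z u :
  birth_time S w u + S u w <= birth_time S w (b :: z ++ u).
Proof.
elim: z b => [|c z IH] b //=; apply: (le_trans (IH c)) => /=.
by rewrite leeDl// ltW.
Qed.

(** Two suffixes of [v] are comparable, and the longer one is born only when the shorter one has
    already split, so they cannot live at the same time. *)
Lemma alive_suffix_eq s u u' v : alive S D w s u -> alive S D w s u' ->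
  suffix u v -> suffix u' v -> u = u'.
Proof.
wlog uu' : u u' / (size u <= size u')%N.
  move=> H; case: (leqP (size u) (size u')) => [|/ltnW] uu' au au' uv u'v.
    exact: H.
  by apply/esym; exact: H.
move=> [_ _ au] [_ au' _] uv u'v.
have [z u'E] : exists z, u' = z ++ u.
  (* Both lists are obtained from [v] by dropping letters, so dropping from the longer one gives the
     shorter one. *)
  exists (take (size u' - size u) u').
  rewrite -[LHS](cat_take_drop (size u' - size u)); congr (_ ++ _).
  have u'v_size := size_suffix u'v.
  move: uv u'v; rewrite !suffixE => /eqP uE /eqP u'E.
  rewrite -{2}u'E drop_drop -[RHS]uE; congr drop.
  by rewrite addnC addnBA// subnK.
case: z u'E => [//|c z] u'E; exfalso.
move: au'; apply/negP; rewrite -ltNge u'E.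
apply: lt_le_trans (birth_time_cat _ _ _).
by apply: lt_le_trans au _; rewrite leeD2l// ge_min lexx.
Qed.

(** Sending a lineage alive at t to its ancestor alive at s reaches every lineage counted at s. This
    bound is the source of all integrability of M on the event N_t = n. *)
Lemma recon_le s t : recon S D s t w <= recon S D t t w.
Proof.
rewrite /recon; apply: counting_card_le.
pose B : set lineage := [set u | alive S D w t u /\ exists v, suffix u v /\ alive S D w t v].
(* The default [[::]] is taken only by lineages without an ancestor alive at s; surjectivity is not
   affected. *)
pose f (v : lineage) : lineage := xget [::] [set u | alive S D w s u /\ suffix u v].
apply: card_le_trans (card_image_le f B).
apply: subset_card_le => u [au [v [uv av]]]; exists v.
  by split => //; exists v; rewrite suffix_refl.
rewrite /f; case: xgetP => [u' _ [au' u'v]|/(_ u)]; last by case.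
exact: alive_suffix_eq au' au u'v uv.
Qed.

Lemma recon_root_alive s t : (0 <= s)%R -> s%:E < mine (S [::] w) (D [::] w) ->
  (exists v, alive S D w t v) -> recon S D s t w = 1.
Proof.
move=> s0 sSD tv; rewrite /recon (_ : [set _ | _] = [set [::]]).
  by rewrite /counting asboolT ?fset_set1 ?cardfs1.
apply/seteqP; split => [u [+ _]|u -> /=]; last first.
  split; first exact/alive_nil.
  by case: tv => v av; exists v; rewrite suffix0s.
case/lastP: u => [//|v b] [_]; rewrite birth_time_rcons => H; exfalso.
move: sSD; rewrite lt_min => /andP[+ _]; rewrite ltNge => /negP; apply.
apply: le_trans H; rewrite leeDl//.
exact: (@birth_time_ge0 (subtree b S) w v (fun u => Spos (rcons u b))).
Qed.

End positive_clocks.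

Lemma recon_neq0 S D w s t : recon S D s t w != 0 -> exists v, alive S D w t v.
Proof.
move=> r0; apply: contrapT => nv; move: r0 => /eqP; apply.
rewrite /recon (_ : [set _ | _] = set0).
  by rewrite /counting asboolT ?fset_set0.
by apply/seteqP; split => // u [_ [v [_ av]]]; apply: nv; exists v.
Qed.

End paths.

Lemma num_reconstructed1 {T : Type} {R : realType} (S D : lineage -> T -> \bar R)
  (t : R) : num_reconstructed S D 1 t = recon S D t t.
Proof. by rewrite /num_reconstructed mul1r. Qed.

(** * Measurability of the tree functionals *)

Section measurability.
Context {d} {T : measurableType d} {R : realType}.
Variables S D : lineage -> T -> \bar R.
Hypothesis mS : forall u, measurable_fun setT (S u).
Hypothesis mD : forall u, measurable_fun setT (D u).

Lemma measurable_birth_time u : measurable_fun setT (fun w => birth_time S w u).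
Proof.
by elim: u => [|b u IH] /=; [exact: measurable_cst|exact: emeasurable_funD].
Qed.

Lemma measurable_born u : measurable [set w | born S D w u].
Proof.
elim: u => [|b u IH] /=; first by rewrite (_ : [set _ | _] = setT)//; apply/seteqP.
rewrite (_ : [set _ | _] = [set w | born S D w u] `&` [set w | S u w < D u w]%E)//.
apply: measurableI => //; rewrite -[X in measurable X]setTI.
exact: measurable_lte.
Qed.

(** The observation time is itself random: on a subtree it is the remaining time after the random
    split of the root. *)
Lemma measurable_alive (f : T -> R) u : measurable_fun setT f ->
  measurable [set w | alive S D w (f w) u].
Proof.
move=> mf.
rewrite (_ : [set _ | _] = [set w | born S D w u] `&`
   ([set w | birth_time S w u <= (f w)%:E]%E `&`
    [set w | (f w)%:E < birth_time S w u + mine (S u w) (D u w)]%E)); last first.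
  by apply/seteqP; split => [w [? ? ?]|w [? [? ?]]].
apply: measurableI; first exact: measurable_born.
have mfE : measurable_fun setT (fun w => (f w)%:E) by exact/measurable_EFinP.
have mb := measurable_birth_time u.
apply: measurableI; rewrite -[X in measurable X]setTI.
  exact: measurable_lee.
apply: measurable_lte => //; apply: emeasurable_funD => //.
exact: measurable_mine.
Qed.

Lemma measurable_recon (f g : T -> R) :
  measurable_fun setT f -> measurable_fun setT g ->
  measurable_fun setT (fun w => recon S D (f w) (g w) w).
Proof.
move=> mf mg; apply: measurable_fun_counting => u.
(* The existence of a living descendant is a union over the countably many lineages. *)
rewrite (_ : [set _ | _] = [set w | alive S D w (f w) u] `&`
  \bigcup_v (if suffix u v then [set w | alive S D w (g w) v] else set0)); last first.
  apply/seteqP; split => [w [? [v [uv ?]]]|w [? [v _]]].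
    by split => //; exists v => //; rewrite uv.
  by case: ifPn => // uv ?; split => //; exists v.
apply: measurableI; first exact: measurable_alive.
apply: countable_bigcupT_measurable; first exact: countableP.
by move=> v; case: ifP => // _; exact: measurable_alive.
Qed.

End measurability.

(** * Independence of disjoint sets of clocks *)

Section independence.
Local Open Scope ereal_scope.
Context {d : measure_display} {T : measurableType d} {R : realType}.
Variable P : probability T R.

(** In [A], both sides are finite measures, the restriction of P to E and a multiple of P, so
    agreement on a pi-system containing the whole space is enough. *)
Lemma indep_pi_system (G : set (set T)) (E : set T) :
  G `<=` measurable -> setI_closed G -> G setT -> measurable E ->
  (forall A, G A -> P (A `&` E) = P E * P A) ->
  forall A, <<s G >> A -> P (A `&` E) = P E * P A.
Proof.
move=> Gm GI GT mE H.
pose r : {nonneg R} := NngNum (fine_ge0 (measure_ge0 P E)).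
have rE A : mscale r P A = P E * P A.
  by rewrite /mscale /= fineK// fin_num_measure.
move=> A GA; rewrite -rE -[LHS]/(mrestr P mE A).
apply: (g_sigma_algebra_measure_unique G Gm (fun=> setT)) => //.
- by apply/seteqP; split => // x _; exists 0%N.
- by move=> B GB; rewrite /= rE /mrestr H.
- by move=> k; rewrite /= /mrestr setTI (le_lt_trans (probability_le1 _ _))// ltry.
Qed.

Section cylinders.
Context {I : choiceType}.
Variable X : I -> T -> \bar R.
Hypothesis mX : forall i, measurable_fun setT (X i).

(** A pi-system generating the sigma-algebra of the clocks in J; its members are exactly the events
    on which [mutually_independent] speaks. *)
Definition cylinder (J : set I) : set (set T) :=
  [set E | exists s : seq I, exists A : I -> set (\bar R),
    [/\ uniq s, forall i, i \in s -> J i,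
        forall i, i \in s -> measurable (A i) &
        E = \bigcap_(i in [set` s]) X i @^-1` A i]].

Lemma measurable_preimage_clock i (A : set (\bar R)) : measurable A ->
  measurable (X i @^-1` A).
Proof. by move=> mA; rewrite -[X in measurable X]setTI; exact: mX. Qed.

Lemma cylinder_measurable J : cylinder J `<=` measurable.
Proof.
move=> _ [s [A [us sJ mA ->]]].
apply: fin_bigcap_measurable => [|i si]; first exact: finite_seq.
exact/measurable_preimage_clock/mA.
Qed.

Lemma sigma_cylinder_measurable J : <<s cylinder J >> `<=` measurable.
Proof.
apply: smallest_sub; [exact: sigma_algebra_measurable|exact: cylinder_measurable].
Qed.

Lemma cylinder_setT J : cylinder J setT.
Proof.
exists [::], (fun=> setT); split => //.
by apply/seteqP; split => // w _ i.
Qed.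

Lemma cylinder_setI J : setI_closed (cylinder J).
Proof.
move=> _ _ [s [A [us sJ mA ->]]] [s' [A' [us' sJ' mA' ->]]].
(* The index lists are merged; a clock absent from one of them is constrained by [setT] on that
   side. *)
exists (undup (s ++ s')), (fun i => (if i \in s then A i else setT) `&`
  (if i \in s' then A' i else setT)); split.
- exact: undup_uniq.
- by move=> i; rewrite mem_undup mem_cat => /orP[]; [exact: sJ|exact: sJ'].
- move=> i _; apply: measurableI; first by case: ifP => // /mA.
  by case: ifP => // /mA'.
- apply/seteqP; split => [w [H H'] i _|w H]; first split.
  + by case: ifP => // si; exact: H.
  + by case: ifP => // si; exact: H'.
  + split => i /= si; (have : i \in undup (s ++ s') by rewrite mem_undup mem_cat si ?orbT);
      by move=> /H []; rewrite si.
Qed.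

Lemma cylinder_sub J J' : J `<=` J' -> cylinder J `<=` cylinder J'.
Proof.
move=> JJ' _ [s [A [us sJ mA ->]]]; exists s, A; split => // i /sJ.
exact: JJ'.
Qed.

Lemma sigma_cylinder_sub J J' : J `<=` J' ->
  <<s cylinder J >> `<=` <<s cylinder J' >>.
Proof. by move=> JJ'; apply: sub_sigma_algebra2; exact: cylinder_sub. Qed.

Lemma sigma_cylinder1 J i A : J i -> measurable A ->
  <<s cylinder J >> (X i @^-1` A).
Proof.
move=> Ji mA; apply: sub_sigma_algebra; exists [:: i], (fun=> A); split => //.
  by move=> j; rewrite inE => /eqP ->.
apply/seteqP; split => [w H j|w]; first by rewrite /= inE => /eqP ->.
by apply; rewrite /= inE.
Qed.

Hypothesis indepX : mutually_independent P X.

Lemma indep_cylinder (J J' : set I) E E' : (forall i, J i -> ~ J' i) ->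
  cylinder J E -> cylinder J' E' -> P (E `&` E') = P E * P E'.
Proof.
move=> JJ' [s [A [us sJ mA ->]]] [s' [A' [us' sJ' mA' ->]]].
pose B i := if i \in s then A i else A' i.
have BA i : i \in s -> B i = A i by rewrite /B => ->.
have BA' i : i \in s' -> B i = A' i.
  by rewrite /B; case: ifP => // /sJ /JJ' + /sJ'.
have -> : (\bigcap_(i in [set` s]) X i @^-1` A i) `&`
    (\bigcap_(i in [set` s']) X i @^-1` A' i) =
    \bigcap_(i in [set` (s ++ s')]) X i @^-1` B i.
  apply/seteqP; split => [w [H H'] i|w H].
    rewrite /= mem_cat => /orP[] si; first by rewrite BA//; exact: H.
    by rewrite BA'//; exact: H'.
  split => i /= si.
    by rewrite /= -BA//; apply: H; rewrite /= mem_cat si.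
  by rewrite /= -BA'//; apply: H; rewrite /= mem_cat si orbT.
rewrite !indepX//.
- rewrite big_cat /=; congr (_ * _); rewrite big_seq [RHS]big_seq.
    by apply: eq_bigr => i ?; rewrite BA.
  by apply: eq_bigr => i ?; rewrite BA'.
- rewrite cat_uniq us us' andbT /=; apply/hasPn => i /= /sJ' J'i.
  by apply/negP => /sJ /JJ'.
- by move=> i; rewrite mem_cat => /orP[] si; [rewrite BA//; exact: mA|rewrite BA'//; exact: mA'].
Qed.

(** The pi-system argument is applied once in each of the two events. *)
Lemma indep_sigma_cylinder (J J' : set I) E E' : (forall i, J i -> ~ J' i) ->
  <<s cylinder J >> E -> <<s cylinder J' >> E' -> P (E `&` E') = P E * P E'.
Proof.
move=> JJ' JE J'E'.
rewrite muleC; move: E JE; apply: indep_pi_system.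
- exact: cylinder_measurable.
- exact: cylinder_setI.
- exact: cylinder_setT.
- exact: sigma_cylinder_measurable J'E'.
- move=> A JA; rewrite muleC setIC.
  move: E' J'E'; apply: indep_pi_system.
  + exact: cylinder_measurable.
  + exact: cylinder_setI.
  + exact: cylinder_setT.
  + exact: cylinder_measurable JA.
  + by move=> B JB; rewrite setIC (indep_cylinder JJ').
Qed.

End cylinders.

(** Independence says that the joint law of X and Y is the product of their laws, so Tonelli allows
    integrating Y first with X frozen. *)
Lemma indep_fubini {d1 d2} {T1 : measurableType d1} {T2 : measurableType d2}
    (X : {RV P >-> T1}) (Y : {RV P >-> T2}) (h : T1 * T2 -> \bar R) :
  (forall A B, measurable A -> measurable B ->
     P (X @^-1` A `&` Y @^-1` B) = P (X @^-1` A) * P (Y @^-1` B)) ->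
  measurable_fun setT h -> (forall z, 0 <= h z) ->
  \int[P]_w h (X w, Y w) = \int[distribution P X]_x \int[P]_w h (x, Y w).
Proof.
move=> XY mh h0.
have mXY : measurable_fun setT (fun w => (X w, Y w)) by exact: measurable_fun_pair.
pose XY_mixin := isMeasurableFun.Build _ _ _ _ _ mXY.
pose Z : {RV P >-> (T1 * T2)%type} := HB.pack (fun w => (X w, Y w)) XY_mixin.
transitivity (\int[distribution P Z]_z h z).
  by rewrite ge0_integral_distribution.
rewrite (eq_measure_integral (distribution P X \x distribution P Y)).
  by rewrite fubini_tonelli1//; apply: eq_integral => x _;
    rewrite /fubini_F ge0_integral_distribution//; exact: measurableT_comp.
by move=> A mA _; apply/esym/product_measure_unique.
Qed.

End independence.

(** * Exponential clocks *)

Section exponential_law.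
Local Open Scope ereal_scope.
Context {R : realType} (r : R).
Hypothesis r_gt0 : (0 < r)%R.
Let mu := @lebesgue_measure R.

Let mpdf : measurable_fun setT (fun x : R => (exponential_pdf r x)%:E).
Proof. by apply/measurable_EFinP; exact: measurable_exponential_pdf. Qed.

Lemma exponential_prob_dominates : exponential_prob r `<< mu.
Proof.
apply/null_content_dominatesP => A mA muA0.
apply: null_set_integral => //; exact: measurable_funTS.
Qed.

(** [exponential_prob] has the same integrals over events as its density, so its Radon-Nikodym
    derivative is that density almost everywhere. *)
Lemma ge0_integral_exponential_prob (f : R -> \bar R) :
  measurable_fun setT f -> (forall x, 0 <= f x) ->
  \int[exponential_prob r]_x f x = \int[mu]_x (f x * (exponential_pdf r x)%:E).
Proof.
move=> mf f0; have dom := exponential_prob_dominates.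
rewrite -(Radon_Nikodym_SigmaFinite.change_of_variables dom f0 measurableT mf).
have mRN := measurable_int _ (Radon_Nikodym_SigmaFinite.f_integrable dom).
apply: ae_eq_integral => //; [exact: emeasurable_funM|exact: emeasurable_funM|].
apply: ae_eqe_mul2l; apply: integral_ae_eq => //.
- exact: Radon_Nikodym_SigmaFinite.f_integrable.
- by move=> E _ mE; rewrite -Radon_Nikodym_SigmaFinite.f_integral.
Qed.

Lemma exponential_prob_ray (x : R) : (0 <= x)%R ->
  exponential_prob r `]x, +oo[ = (expR (- r * x))%:E.
Proof.
move=> x0; rewrite /exponential_prob integral_itv_obnd_cbnd; last exact: measurable_funTS.
have cexp : continuous (fun z : R => expR (- r * z)).
  move=> z; apply: continuous_comp; last exact: continuous_expR.
  exact: mulrl_continuous.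
rewrite (@ge0_continuous_FTC2y _ _ (fun x => - (expR (- r * x)))%R _ 0%R).
- by rewrite EFinN oppeK add0e.
- by move=> y _; apply: exponential_pdf_ge0; exact: ltW.
- apply: (@continuous_subspaceW R^o _ _ [set` `[0%R, +oo[%R]).
    exact: subset_itvr.
  exact: within_continuous_exponential_pdf.
- rewrite -oppr0; apply: cvgN.
  rewrite (_ : (fun x => expR (- r * x)) =
               (fun z => expR (- z)) \o (fun z => r * z))%R; last first.
    by apply: eq_fun => y; rewrite mulNr.
  apply: (@cvg_comp _ _ _ _ _ _ (pinfty_nbhs R)); last exact: cvgr_expR.
  exact: gt0_cvgMry.
- by move=> y _; exact: ex_derive.
- by apply: cvgN; apply/cvg_at_right_filter; exact: cexp.
- move=> y; rewrite in_itv/= andbT => xy; apply: derive1_exponential_pdf.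
  by rewrite in_itv/= andbT (le_lt_trans x0).
Qed.

End exponential_law.

Section clock_law.
Local Open Scope ereal_scope.
Context {d : measure_display} {T : measurableType d} {R : realType}.
Variables (P : probability T R) (r : R).

Lemma exponential_clock_gt0 (X : {RV P >-> \bar R}) : exponential_clock P r X ->
  P [set w | 0 < X w] = 1.
Proof. by move=> /(_ 0%R (lexx _)); rewrite mulr0 expR0. Qed.

Hypothesis r_gt0 : (0 < r)%R.
Variable X : {RV P >-> \bar R}.
Hypothesis Xr : exponential_clock P r X.

Lemma exponential_clock_lty : P [set w | X w = +oo] = 0.
Proof.
have mX : measurable [set w | X w = +oo].
  by rewrite -[X in measurable X]setTI; apply: measurable_eqe.
have H x : (0 <= x)%R -> P [set w | X w = +oo] <= (expR (- r * x))%:E.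
  move=> x0; rewrite -Xr//; apply: le_measure; rewrite ?inE//.
    by rewrite -[X in measurable X]setTI; apply: measurable_lte.
  by move=> w /= ->; rewrite ltry.
apply/eqP; rewrite eq_le measure_ge0 andbT leNgt; apply/negP => p0.
have pfin : P [set w | X w = +oo] \is a fin_num by exact: fin_num_measure.
move: p0 H; rewrite -(fineK pfin) lte_fin; set p := fine _ => p0.
(* At this x the bound reads p <= exp(-1/p), which contradicts exp(1/p) >= 1 + 1/p > 1/p. *)
have x0 : (0 <= p^-1 / r)%R by rewrite divr_ge0// ?invr_ge0 ltW.
move=> /(_ _ x0); rewrite lee_fin.
rewrite mulNr mulrCA divff ?gt_eqF// mulr1 expRN leNgt => /negP; apply.
rewrite -[ltRHS]invrK ltf_pV2 ?posrE ?expR_gt0 ?invr_gt0//.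
by rewrite (lt_le_trans _ (expR_ge1Dx _))// ltrDr.
Qed.

(** [fine] sends the value +oo to 0, which is harmless because that value has probability 0. The law
    is then determined by its mass on open rays, which form a pi-system. *)
Lemma distribution_exponential_clock (A : set R) (Y : {RV P >-> measurableTypeR R}) :
  (forall w, Y w = fine (X w)) -> measurable A ->
  distribution P Y A = exponential_prob r A.
Proof.
move=> YX mA.
have gen : @measurable _ (measurableTypeR R) = <<s (@RGenOInfty.G R) >> by exact: RGenOInfty.measurableE.
have ray x : (0 <= x)%R -> distribution P Y `]x, +oo[ = (expR (- r * x))%:E.
  move=> x0; rewrite -Xr// -[LHS]/(P (Y @^-1` _)).
  apply/eqP; rewrite eq_le; apply/andP; split.
    apply: le_measure; rewrite ?inE//.
    - by rewrite -[X in measurable X]setTI; exact: measurable_funPT.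
    - by rewrite -[X in measurable X]setTI; apply: measurable_lte.
    - move=> w /=; rewrite in_itv/= andbT YX; case: (X w) => //= y.
        by rewrite ltry.
      by move: x0; rewrite leNgt y.
  rewrite -[leRHS]adde0 -exponential_clock_lty.
  apply: le_trans (measureU2 _ _ _); last 2 first.
  - by rewrite -[X in measurable X]setTI; exact: measurable_funPT.
  - by rewrite -[X in measurable X]setTI; apply: measurable_eqe.
  apply: le_measure; rewrite ?inE//.
  - by rewrite -[X in measurable X]setTI; apply: measurable_lte.
  - apply: measurableU; rewrite -[X in measurable X]setTI.
      exact: measurable_funPT.
    exact: measurable_eqe.
  - move=> w /=; rewrite in_itv/= andbT YX; case: (X w) => //= y; last by right.
    by rewrite lte_fin; left.
(* Rays starting below 0 have full mass, since the ray at 0 already has. *)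
have le1 (Q : probability (measurableTypeR R) R) (x : R) : Q `]0%R, +oo[%classic = 1 -> (x < 0)%R -> Q `]x, +oo[%classic = 1.
  move=> Q1 x0; apply/eqP; rewrite eq_le probability_le1//= -Q1.
  by apply: le_measure; rewrite ?inE//; apply: subset_itvr; rewrite bnd_simp ltW.
pose E : probability (measurableTypeR R) R :=
  exponential_distribution_exponential_prob__canonical__probability_measure_Probability r_gt0.
rewrite -[RHS]/(E A).
apply: (@measure_unique _ R (measurableTypeR R) _ (fun n => `](- n%:R)%R, +oo[%classic)
  gen _ _ _ (distribution P Y) E) => //.
- move=> _ _ [x ->] [y ->]; exists (Num.max x y).
  apply/seteqP; split => z /=; rewrite !in_itv/= !andbT gt_max; first by move=> [-> ->].
  by move=> /andP[].
- by move=> n; exists (- n%:R)%R.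
- apply/seteqP; split => // x _; exists (Num.truncn `|x|%R).+1 => //=.
  rewrite in_itv/= andbT ltrNl (le_lt_trans _ (Num.Theory.truncnS_gt _))//.
  by rewrite -normrN ler_norm.
- move=> _ [x ->]; have [x0|x0] := leP 0%R x.
    by transitivity (expR (- r * x))%:E; [exact: ray|exact/esym/exponential_prob_ray].
  transitivity (1 : \bar R); [|apply/esym]; apply: le1 => //.
    by etransitivity; [exact: ray|rewrite mulr0 expR0].
  by etransitivity; [exact: exponential_prob_ray|rewrite mulr0 expR0].
- by move=> n; rewrite (le_lt_trans (probability_le1 _ _))// ltry.
Qed.

End clock_law.

(** * The first split *)

Lemma mutually_independent_comp {d} {T : measurableType d} {R : realType}
    (P : probability T R) (I J : choiceType) (X : J -> T -> \bar R) (f : I -> J) :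
  injective f -> mutually_independent P X ->
  mutually_independent P (fun i => X (f i)).
Proof.
move=> finj indX s A us mA.
(* By injectivity at most one index i contributes to [A' j]. *)
pose A' j := [set x | exists i, [/\ f i = j, i \in s & A i x]].
have A'E i : i \in s -> A' (f i) = A i.
  move=> si; apply/seteqP; split => [x [k [/finj <-]]//|x Ax]; by exists i.
have := indX (map f s) A'; rewrite map_inj_uniq// => /(_ us).
have -> : \bigcap_(i in [set` map f s]) X i @^-1` A' i =
          \bigcap_(i in [set` s]) X (f i) @^-1` A i.
  apply/seteqP; split => [w H i /= si|w H _ /mapP[i si ->]]; rewrite /preimage/=.
    by rewrite -A'E//; apply: H; rewrite /= map_f.
  by rewrite A'E//; exact: H.
move=> -> ; last by move=> _ /mapP[i si ->]; rewrite A'E//; exact: mA.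
by rewrite big_map big_seq [RHS]big_seq; apply: eq_bigr => i si; rewrite A'E.
Qed.

Lemma birth_death_clocks_subtree {d} {T : measurableType d} {R : realType}
    (P : probability T R) (lambda mu : R) (S D : lineage -> {RV P >-> \bar R}) b :
  birth_death_clocks lambda mu S D ->
  birth_death_clocks lambda mu (subtree b S) (subtree b D).
Proof.
move=> [hS hD ind]; split => [u|u|]; [exact: hS|exact: hD|].
pose f (i : lineage + lineage) : lineage + lineage :=
  match i with inl u => inl (rcons u b) | inr u => inr (rcons u b) end.
have finj : injective f by move=> [u|u] [v|v] //= [] /rcons_inj[->].
have := mutually_independent_comp finj ind.
by congr (mutually_independent P _); apply/funext => -[].
Qed.

Section branching.
Local Open Scope ereal_scope.
Context {d : measure_display} {T : measurableType d} {R : realType}.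
Variables (P : probability T R) (lambda mu : R).
Variables S D : lineage -> {RV P >-> \bar R}.
Hypothesis lambda_gt0 : (0 < lambda)%R.
Hypothesis SD_clocks : birth_death_clocks lambda mu S D.

Let clock (i : lineage + lineage) : T -> \bar R :=
  match i with inl u => S u | inr u => D u end.

Let mclock i : measurable_fun setT (clock i).
Proof. by case: i => u; exact: measurable_funPT. Qed.

(** The space T under the sigma-algebra of the clocks in J alone. A function measurable on it
    depends on these clocks only, and the identity into it, [clocks_id], is a random variable
    carrying all of them at once; disjoint families of clocks thus become two independent
    variables. *)
Definition clocksT (J : set (lineage + lineage)) :=
  g_sigma_algebraType (cylinder clock J).
HB.instance Definition _ J := Measurable.on (clocksT J).

Definition subtree_index b : set (lineage + lineage) :=
  [set i | exists v, i = inl (rcons v b) \/ i = inr (rcons v b)].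

Let measurable_id_clocksT J : measurable_fun setT (fun w : T => w : clocksT J).
Proof.
move=> _ A mA; rewrite setTI preimage_id.
exact: (sigma_cylinder_measurable mclock mA).
Qed.

Definition clocks_id J : {RV P >-> clocksT J} :=
  HB.pack (fun w : T => w : clocksT J)
    (isMeasurableFun.Build _ _ _ _ _ (@measurable_id_clocksT J)).

Lemma integral_indep (J J' : set (lineage + lineage)) (f g : T -> \bar R) :
  (forall i, J i -> ~ J' i) ->
  measurable_fun setT (f : clocksT J -> \bar R) -> 
  measurable_fun setT (g : clocksT J' -> \bar R) ->
  (forall w, 0 <= f w) -> (forall w, 0 <= g w) ->
  \int[P]_w (f w * g w) = (\int[P]_w f w) * (\int[P]_w g w).
Proof.
move=> JJ' mf mg f0 g0.
pose h (z : clocksT J * clocksT J') := f z.1 * g z.2.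
have mfT : measurable_fun setT f by exact: (measurableT_comp mf (@measurable_id_clocksT J)).
have mgT : measurable_fun setT g by exact: (measurableT_comp mg (@measurable_id_clocksT J')).
have := @indep_fubini _ _ _ P _ _ _ _ (clocks_id J) (clocks_id J') h.
rewrite /h /= => ->.
- rewrite -[in RHS](@ge0_integral_distribution _ _ _ _ _ _ (clocks_id J) f)//.
  rewrite -ge0_integralZr//; last exact: integral_ge0.
  by apply: eq_integral => w _; rewrite ge0_integralZl.
- move=> A B mA mB; case: SD_clocks => _ _ ind.
  exact: (indep_sigma_cylinder mclock ind JJ' mA mB).
- by apply: emeasurable_funM; exact: measurableT_comp.
- by move=> z; exact: mule_ge0.
Qed.

Lemma measurable_clocksT (J : set (lineage + lineage)) i : J i ->
  measurable_fun setT (clock i : clocksT J -> \bar R).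
Proof. by move=> Ji _ A mA; rewrite setTI; exact: sigma_cylinder1. Qed.

Lemma measurable_id_sub (J J' : set (lineage + lineage)) : J `<=` J' ->
  measurable_fun setT (fun w : clocksT J' => w : clocksT J).
Proof. by move=> JJ' _ A mA; rewrite setTI preimage_id; exact: (sigma_cylinder_sub JJ'). Qed.

Let measurable_fine_root :
  measurable_fun setT (fun w => fine (S [::] w) : measurableTypeR R).
Proof. by apply: measurableT_comp => //; exact: fine_measurable. Qed.

Definition root_split_time : {RV P >-> measurableTypeR R} :=
  HB.pack (fun w => fine (S [::] w) : measurableTypeR R)
    (isMeasurableFun.Build _ _ _ _ _ measurable_fine_root).

(** As J excludes the split clock of the root, this clock is independent of the second argument of
    [h] and can be integrated last, against its density. *)
Lemma integral_root (J : set (lineage + lineage))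
    (h : measurableTypeR R * clocksT J -> \bar R) :
  ~ J (inl [::]) -> measurable_fun setT h -> (forall z, 0 <= h z) ->
  \int[P]_w h (fine (S [::] w), w) =
  \int[lebesgue_measure]_x
    ((\int[P]_w h (x, w)) * (exponential_pdf lambda x)%:E).
Proof.
move=> J0 mh h0.
have [hS _ ind] := SD_clocks.
have := @indep_fubini _ _ _ P _ _ _ _ root_split_time (clocks_id J) h.
rewrite /= => ->//; last first.
  move=> A B mA mB; apply: (@indep_sigma_cylinder _ _ _ P _ clock mclock ind [set inl [::]] J) => //.
    by move=> i /= ->.
  rewrite (_ : _ @^-1` A = clock (inl [::]) @^-1` (fine @^-1` A)) //.
  apply: sigma_cylinder1 => //.
  by rewrite -[X in measurable X]setTI; exact: fine_measurable.
rewrite (eq_measure_integral (exponential_prob lambda)); last first.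
  move=> A mA _.
  exact: (distribution_exponential_clock lambda_gt0 (hS [::])).
rewrite (ge0_integral_exponential_prob lambda_gt0)//.
- have := @measurable_fun_fubini_tonelli_F _ _ _ _ R (distribution P (clocks_id J)) h mh h0.
  congr (measurable_fun setT _); apply/funext => x; rewrite /fubini_F.
  rewrite ge0_integral_distribution//; exact: measurableT_comp.
- by move=> x; exact: integral_ge0.
Qed.

(** The bounds 0 < S <= s make the split time finite, so [fine] keeps its value, and match the
    interval of integration. *)
Definition root_split (s : R) : set T :=
  [set w | [/\ 0 < S [::] w, S [::] w < D [::] w & S [::] w <= s%:E]].

(** This is the branching property: given a split at x, the death clock of the root contributes the
    tail e^(-mu x), and what the two subtrees do afterwards depends on disjoint families of
    clocks. *)
Lemma branch_integral (s : R)
    (h0 : measurableTypeR R * clocksT (subtree_index false) -> \bar R)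
    (h1 : measurableTypeR R * clocksT (subtree_index true) -> \bar R) :
  measurable_fun setT h0 -> measurable_fun setT h1 ->
  (forall z, 0 <= h0 z) -> (forall z, 0 <= h1 z) ->
  \int[P]_(w in root_split s) (h0 (fine (S [::] w), w) * h1 (fine (S [::] w), w)) =
  \int[lebesgue_measure]_(x in `]0%R, s])
    ((lambda * expR (- (lambda + mu) * x))%:E *
     ((\int[P]_w h0 (x, w)) * (\int[P]_w h1 (x, w)))).
Proof.
move=> mh0 mh1 h00 h10.
have [_ hD ind] := SD_clocks.
pose J : set (lineage + lineage) := [set~ inl [::]].
have bJ b : subtree_index b `<=` J.
  by move=> i [v [->|->]] //= [] /(congr1 size); rewrite size_rcons.
have clocks_idb b : measurable_fun setT
    (fun z : measurableTypeR R * clocksT J =>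
       z : measurableTypeR R * clocksT (subtree_index b)).
  rewrite (_ : (fun z => z) = fun z => (z.1, z.2)); last by apply/funext => -[].
  apply: measurable_fun_pair; first exact: measurable_fst.
  exact: (measurableT_comp (measurable_id_sub (@bJ b)) measurable_snd).
(* The event [root_split], with the split time as a separate variable so that [integral_root]
   applies. *)
pose A : set (measurableTypeR R * clocksT J) :=
  [set z | (0 < z.1 <= s)%R] `&` [set z | z.1%:E < D [::] z.2].
have mD : measurable_fun setT (fun z : measurableTypeR R * clocksT J => D [::] z.2).
  have mDJ : measurable_fun setT (D [::] : clocksT J -> \bar R).
    exact: (@measurable_clocksT J (inr [::])).
  exact: (measurableT_comp mDJ measurable_snd).
have m1 : measurable_fun setT (fun z : measurableTypeR R * clocksT J => z.1%:E).
  by apply/measurable_EFinP; exact: measurable_fst.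
have mA : measurable A.
  apply: measurableI; last first.
    by rewrite -[X in measurable X]setTI; exact: measurable_lte.
  rewrite (_ : [set _ | _] = fst @^-1` `]0%R, s]); last first.
    by apply/seteqP; split => z /=; rewrite in_itv.
  by rewrite -[X in measurable X]setTI; exact: measurable_fst.
pose h z := (\1_A z)%:E * (h0 z * h1 z).
have mh : measurable_fun setT h.
  apply: emeasurable_funM; first by apply/measurable_EFinP; exact: measurable_indic.
  by apply: emeasurable_funM; [exact: (measurableT_comp mh0)|exact: (measurableT_comp mh1)].
have h_ge0 z : 0 <= h z by rewrite !mule_ge0// lee_fin.
transitivity (\int[P]_w h (fine (S [::] w), w)).
  rewrite integral_mkcond; apply: eq_integral => w _; rewrite patchE /h indicE.
  have -> : (w \in root_split s) = ((fine (S [::] w), w) \in A).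
    apply/idP/idP => /set_mem.
      move=> [S0 SD Ss]; apply/mem_set; rewrite /A /=.
      move: S0 SD Ss; case: (S [::] w) => //= r; rewrite !lte_fin !lee_fin.
      by move=> -> -> ->.
    move=> [/= /andP[S0 Ss] SD]; apply/mem_set; rewrite /root_split /=.
    move: S0 Ss SD; case: (S [::] w) => [x||] /= S0; [|by rewrite ltxx in S0..].
    by move=> Ss SD; split; rewrite ?lte_fin ?lee_fin.
  by case: ifPn => _; rewrite ?mul1e ?mul0e.
rewrite (integral_root _ mh h_ge0); last by move=> /(_ erefl).
rewrite [RHS]integral_mkcond; apply: eq_integral => x _; rewrite patchE.
case: ifPn => [/set_mem /=|]; last first.
  move=> xs; rewrite integral0_eq ?mul0e// => w _.
  rewrite /h indicE memNset ?mul0e// => -[/= x0s _].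
  by move/negP: xs; apply; apply/mem_set; rewrite /= in_itv.
rewrite in_itv/= => /andP[x0 xs].
rewrite exponential_pdfE ?(ltW x0)//.
(* For x in the interval, the event reduces to the root outliving x. *)
pose B := [set w | x%:E < D [::] w].
have -> : \int[P]_w h (x, w) = \int[P]_w ((\1_B w)%:E * (h0 (x, w) * h1 (x, w))).
  apply: eq_integral => w _; rewrite /h !indicE; congr ((nat_of_bool _)%:R%:E * _).
  apply/idP/idP => /set_mem; first by move=> [_ xD]; apply/mem_set.
  by move=> xD; apply/mem_set; split => //=; rewrite x0 xs.
have mpairJ (J' : set (lineage + lineage)) : measurable_fun setT (fun w : clocksT J' => (x : measurableTypeR R, w)).
  exact: measurable_fun_pair.
pose JU := subtree_index false `|` subtree_index true.
have bJU b : subtree_index b `<=` JU by case: b => i ?; [right|left].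
have clocks_idU b := measurable_id_sub (@bJU b).
(* The death clock of the root is separated from both subtrees first, then the subtrees from each
   other. *)
rewrite (@integral_indep [set inr [::]] JU)//.
- rewrite (@integral_indep (subtree_index false) (subtree_index true))//.
  + have -> : \int[P]_w (\1_B w)%:E = (expR (- mu * x))%:E.
      rewrite integral_indic//; last first.
        by rewrite -[X in measurable X]setTI; exact: measurable_lte.
      by rewrite setIT; apply: hD; exact: ltW.
    rewrite -[LHS]muleA [X in _ * X = _]muleC [LHS]muleA -EFinM; congr (_%:E * _).
    by rewrite mulrCA -expRD; congr (_ * expR _)%R; ring.
  + move=> i [v iv] [v' iv'].
    by case: iv iv' => -> [] // [] /rcons_inj[].
  + exact: (measurableT_comp mh0).
  + exact: (measurableT_comp mh1).
- move=> i /= -> [] [v [//|[]]] /(congr1 size); rewrite size_rcons//.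
- apply/measurable_EFinP; apply: measurable_indic.
  rewrite (_ : B = clock (inr [::]) @^-1` `]x%:E, +oo[%classic).
    by apply: sigma_cylinder1 => //; exact: emeasurable_itv.
  by apply/seteqP; split => w /=; rewrite in_itv/= andbT.
- apply: emeasurable_funM.
    exact: (measurableT_comp (measurableT_comp mh0 (mpairJ _)) (clocks_idU _)).
  exact: (measurableT_comp (measurableT_comp mh1 (mpairJ _)) (clocks_idU _)).
- by move=> w; exact: mule_ge0.
Qed.

End branching.

(** With the second projection as [g], clocks can be read on a product of time and outcome; joint
    measurability in both then follows from the results for random times. *)
Lemma recon_comp {T T' : Type} {R : realType} (S D : lineage -> T -> \bar R)
    (g : T' -> T) (s t : R) (z : T') :
  recon (fun u z => S u (g z)) (fun u z => D u (g z)) s t z = recon S D s t (g z).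
Proof.
have bE u : birth_time (fun u z => S u (g z)) z u = birth_time S (g z) u.
  by elim: u => //= b u ->.
have nE u : born (fun u z => S u (g z)) (fun u z => D u (g z)) z u = born S D (g z) u.
  by elim: u => //= b u ->.
by rewrite /recon; congr counting; apply/seteqP; split => u; rewrite /alive /=;
  rewrite nE !bE => -[h [v]]; rewrite ?nE ?bE => hv; split => //; exists v; rewrite ?nE ?bE.
Qed.

Lemma recon_nat {T : Type} {R : realType} (S D : lineage -> T -> \bar R) (s t : R) w :
  recon S D s t w = +oo%E \/ exists n : nat, recon S D s t w = n%:R%:E.
Proof.
by rewrite /recon /counting; case: asboolP => _; [right; eexists|left].
Qed.

Lemma recon_ge0 {T : Type} {R : realType} (S D : lineage -> T -> \bar R) (s t : R) w :
  (0 <= recon S D s t w)%E.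
Proof. exact: counting_ge0. Qed.

(* [recon S D t t] is the population at time [t], since a lineage is a descendant of
   itself. *)
Definition pop_eq {T : Type} {R : realType} (S D : lineage -> T -> \bar R)
  (n : nat) (t : R) (w : T) : R := (recon S D t t w == n%:R%:E)%:R.

Lemma pop_eq_ge0 {T : Type} {R : realType} (S D : lineage -> T -> \bar R) n (t : R) w :
  0 <= pop_eq S D n t w.
Proof. by []. Qed.

Lemma pop_eq_le1 {T : Type} {R : realType} (S D : lineage -> T -> \bar R) n (t : R) w :
  pop_eq S D n t w <= 1.
Proof. by rewrite /pop_eq lern1; case: eqP. Qed.

Lemma pop_eq_comp {T T' : Type} {R : realType} (S D : lineage -> T -> \bar R)
    (g : T' -> T) n (t : R) (z : T') :
  pop_eq (fun u z => S u (g z)) (fun u z => D u (g z)) n t z = pop_eq S D n t (g z).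
Proof. by rewrite /pop_eq recon_comp. Qed.

(** A finite sum forces both terms to be finite, so infinite populations contribute to neither
    side. *)
Lemma convolution_nat {R : realType} (x y : \bar R) (n : nat) :
  (x = +oo \/ exists i : nat, x = i%:R%:E)%E ->
  (y = +oo \/ exists i : nat, y = i%:R%:E)%E ->
  ((x + y)%E == n%:R%:E)%:R =
  \sum_(j < n.+1) (x == j%:R%:E)%:R * (y == (n - j)%:R%:E)%:R :> R.
Proof.
move=> [->|[a ->]].
  move=> _; rewrite big1 => [|j _]; last by rewrite mul0r.
  by case: y.
move=> [->|[b ->]].
  by rewrite big1 => [|j _]; last by rewrite mulr0.
have eqE (i j : nat) : (i%:R%:E == j%:R%:E :> \bar R) = (i == j).
  by rewrite eqe eqr_nat.
rewrite -EFinD -natrD eqE.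
have [abn|abn] := eqVneq (a + b)%N n.
  have an : (a < n.+1)%N by rewrite ltnS -abn leq_addr.
  rewrite (bigD1 (Ordinal an)) //= !eqE eqxx -{1}abn addKn eqxx mulr1.
  rewrite big1 ?addr0// => j ja; rewrite eqE.
  by rewrite (_ : (a == j) = false) ?mul0r//; apply/negbTE; rewrite eq_sym; exact: ja.
rewrite big1// => j _; rewrite !eqE.
case: eqP => [aj|]; rewrite ?mul0r//; case: eqP => [bj|]; rewrite ?mulr0//.
by move: abn; rewrite aj bj subnKC ?eqxx// -ltnS.
Qed.

Lemma measurable_pop_eq {d} {T : measurableType d} {R : realType}
    (S D : lineage -> T -> \bar R) (f : T -> R) (n : nat) :
  (forall u, measurable_fun setT (S u)) -> (forall u, measurable_fun setT (D u)) ->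
  measurable_fun setT f -> measurable_fun setT (fun w => pop_eq S D n (f w) w).
Proof.
move=> mS mD mf.
pose A := [set w | recon S D (f w) (f w) w = n%:R%:E].
rewrite (_ : (fun w => _) = \1_A).
  apply: measurable_indic; rewrite -[X in measurable X]setTI.
  by apply: measurable_eqe => //; exact: measurable_recon.
apply/funext => w; rewrite indicE /pop_eq; congr (nat_of_bool _)%:R.
by apply/eqP/idP => [/mem_set|/set_mem].
Qed.

(** * Expectations on N_t = n as functions of time *)

Section expectations.
Local Open Scope ereal_scope.
Context {d : measure_display} {T : measurableType d} {R : realType}.
Variable P : probability T R.
Implicit Types (S D : lineage -> {RV P >-> \bar R}).

(* [P(N_t = n)] *)
Definition pop_prob S D n (t : R) : R := fine (\int[P]_w (pop_eq S D n t w)%:E).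

(* [E(M_{s,t}; N_t = n)], for [M_{s,t}] the number of lineages at time [s] with
   descendants at time [t] *)
Definition pop_recon S D n (s t : R) : R :=
  fine (\int[P]_w (recon S D s t w * (pop_eq S D n t w)%:E)).

Lemma measurable_pop_prob S D n (g : R -> R) : measurable_fun setT g ->
  measurable_fun setT (fun x => pop_prob S D n (g x)).
Proof.
move=> mg.
pose h (z : R * T) : \bar R := (pop_eq S D n (g z.1) z.2)%:E.
suff mh : measurable_fun setT h.
  apply: (measurableT_comp (@fine_measurable R setT measurableT)).
  apply: (@measurable_fun_fubini_tonelli_F _ _ _ _ _ P h mh).
  by move=> z; rewrite lee_fin pop_eq_ge0.
apply/measurable_EFinP.
rewrite (_ : (fun z => _) = fun z : R * T =>
  pop_eq (fun u z => S u z.2) (fun u z => D u z.2) n (g z.1) z); last first.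
  by apply/funext => z; rewrite -(pop_eq_comp S D snd).
apply: measurable_pop_eq => [u|u|].
- exact: (measurableT_comp (measurable_funPT (S u)) measurable_snd).
- exact: (measurableT_comp (measurable_funPT (D u)) measurable_snd).
- exact: (measurableT_comp mg measurable_fst).
Qed.

Lemma measurable_pop_recon S D n (f g : R -> R) :
  measurable_fun setT f -> measurable_fun setT g ->
  measurable_fun setT (fun x => pop_recon S D n (f x) (g x)).
Proof.
move=> mf mg.
pose h (z : R * T) : \bar R := recon S D (f z.1) (g z.1) z.2 * (pop_eq S D n (g z.1) z.2)%:E.
suff mh : measurable_fun setT h.
  apply: (measurableT_comp (@fine_measurable R setT measurableT)).
  apply: (@measurable_fun_fubini_tonelli_F _ _ _ _ _ P h mh).
  by move=> z; rewrite mule_ge0// ?lee_fin ?pop_eq_ge0// recon_ge0.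
have mS u : measurable_fun setT (fun z : R * T => S u z.2).
  exact: (measurableT_comp (measurable_funPT (S u)) measurable_snd).
have mD u : measurable_fun setT (fun z : R * T => D u z.2).
  exact: (measurableT_comp (measurable_funPT (D u)) measurable_snd).
have mf1 : measurable_fun setT (fun z : R * T => f z.1).
  exact: (measurableT_comp mf measurable_fst).
have mg1 : measurable_fun setT (fun z : R * T => g z.1).
  exact: (measurableT_comp mg measurable_fst).
rewrite (_ : h = fun z : R * T =>
  recon (fun u z => S u z.2) (fun u z => D u z.2) (f z.1) (g z.1) z *
  (pop_eq (fun u z => S u z.2) (fun u z => D u z.2) n (g z.1) z)%:E); last first.
  by apply/funext => z; rewrite (recon_comp S D snd) (pop_eq_comp S D snd).
apply: emeasurable_funM; first exact: measurable_recon.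
by apply/measurable_EFinP; exact: measurable_pop_eq.
Qed.

End expectations.

(** * The three possibilities for the root up to time s *)

Section first_event.
Local Open Scope ereal_scope.
Context {d : measure_display} {T : measurableType d} {R : realType}.
Variables (P : probability T R) (lambda mu : R).
Variables S D : lineage -> {RV P >-> \bar R}.
Hypothesis SD_clocks : birth_death_clocks lambda mu S D.

(** There are countably many lineages, so the null sets of the individual clocks have a null
    union. *)
Lemma ae_clocks_gt0 : {ae P, forall w, forall u, 0 < S u w}.
Proof.
have [hS _ _] := SD_clocks.
have m u : measurable [set w | 0 < S u w].
  by rewrite -[X in measurable X]setTI; exact: measurable_lte.
pose g (n : nat) : lineage := odflt [::] (choice.unpickle n).
have H : {ae P, forall w, forall n : nat, 0 < S (g n) w}.
  apply: ae_foralln => n.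
  exists (~` [set w | 0 < S (g n) w]); split => //; first exact: measurableC.
  transitivity (1 - P [set w | 0 < S (g n) w]); first exact: probability_setC.
  by rewrite (exponential_clock_gt0 (hS _)) subee.
apply: filterS H => w H u; have := H (choice.pickle u).
by rewrite /g choice.pickleK.
Qed.

Lemma measurable_root_split s : measurable (root_split S D s).
Proof.
rewrite (_ : root_split _ _ _ = [set w | 0 < S [::] w] `&`
  ([set w | S [::] w < D [::] w] `&` [set w | S [::] w <= s%:E])); last first.
  by apply/seteqP; split => [w []//|w [? []]].
apply: measurableI; rewrite -[X in measurable X]setTI; first exact: measurable_lte.
rewrite setTI; apply: measurableI; rewrite -[X in measurable X]setTI.
  exact: measurable_lte.
exact: measurable_lee.
Qed.

Definition root_alive (s : R) : set T := [set w | s%:E < mine (S [::] w) (D [::] w)].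
(** A tie counts as a death, in accordance with the strict inequality in [born]. *)
Definition root_dead (s : R) : set T :=
  [set w | D [::] w <= S [::] w /\ D [::] w <= s%:E].

Lemma measurable_root_alive s : measurable (root_alive s).
Proof.
rewrite -[X in measurable X]setTI; apply: measurable_lte => //.
exact: measurable_mine.
Qed.

Lemma measurable_root_dead s : measurable (root_dead s).
Proof.
by apply: measurableI; rewrite -[X in measurable X]setTI; exact: measurable_lee.
Qed.

Lemma root_alive_prob s : (0 <= s)%R ->
  P (root_alive s) = (expR (- (lambda + mu) * s))%:E.
Proof.
move=> s0; have [hS hD ind] := SD_clocks.
have := ind [:: inl [::]; inr [::]] (fun=> `]s%:E, +oo[%classic) erefl.
rewrite !big_cons big_nil mule1.
have rayE (X : T -> \bar R) : X @^-1` `]s%:E, +oo[%classic = [set w | s%:E < X w].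
  by apply/seteqP; split => w /=; rewrite in_itv/= andbT.
rewrite !rayE hS// hD// -EFinM -expRD => H.
rewrite (_ : (- (lambda + mu) * s)%R = (- lambda * s + - mu * s)%R); last by ring.
rewrite -H; last by move=> i _; exact: emeasurable_itv.
congr (P _); apply/seteqP; split => [w|w Hw].
  rewrite /root_alive /= lt_min => /andP[wS wD] i /=.
  rewrite !inE => /orP[] /eqP ->.
    by suff : (S [::] @^-1` `]s%:E, +oo[%classic) w by []; rewrite rayE.
  by suff : (D [::] @^-1` `]s%:E, +oo[%classic) w by []; rewrite rayE.
rewrite /root_alive /= lt_min; apply/andP; split.
  suff : (S [::] @^-1` `]s%:E, +oo[%classic) w by rewrite rayE.
  by apply: (Hw (inl [::])); rewrite /= inE eqxx.
suff : (D [::] @^-1` `]s%:E, +oo[%classic) w by rewrite rayE.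
by apply: (Hw (inr [::])); rewrite /= !inE eqxx orbT.
Qed.

Lemma root_cases s w : 0 < S [::] w ->
  (\1_(root_split S D s) w + \1_(root_alive s) w + \1_(root_dead s) w)%R = 1%R :> R.
Proof.
move=> S0; rewrite !indicE.
have -> : (w \in root_split S D s) = (S [::] w < D [::] w) && (S [::] w <= s%:E).
  by apply/idP/andP => [/set_mem[]//|[? ?]]; apply/mem_set.
have -> : (w \in root_alive s) = (s%:E < S [::] w) && (s%:E < D [::] w).
  by rewrite -lt_min; apply/idP/idP => [/set_mem|?]; [|apply/mem_set].
have -> : (w \in root_dead s) = (D [::] w <= S [::] w) && (D [::] w <= s%:E).
  by apply/idP/andP => [/set_mem[]//|[? ?]]; apply/mem_set.
case: (leP (D [::] w) (S [::] w)) => DS; case: (leP (S [::] w) s%:E) => Ss;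
  case: (leP (D [::] w) s%:E) => Ds /=; rewrite ?addr0 ?add0r//; exfalso.
- by have := lt_le_trans Ds (le_trans DS Ss); rewrite ltxx.
- by have := lt_trans (le_lt_trans Ds Ss) DS; rewrite ltxx.
Qed.

Lemma integral_root_cases (s : R) (f : T -> \bar R) :
  measurable_fun setT f -> (forall w, 0 <= f w) ->
  \int[P]_w f w = \int[P]_(w in root_split S D s) f w +
    \int[P]_(w in root_alive s) f w + \int[P]_(w in root_dead s) f w.
Proof.
move=> mf f0.
have mind A : measurable A -> measurable_fun setT (fun w => (\1_A w)%:E * f w).
  move=> mA; apply: emeasurable_funM => //; apply/measurable_EFinP.
  exact: measurable_indic.
have ind0 A w : 0 <= (\1_A w)%:E * f w by rewrite mule_ge0// lee_fin.
have indE A : \int[P]_(w in A) f w = \int[P]_w ((\1_A w)%:E * f w).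
  rewrite integral_mkcond; apply: eq_integral => w _; rewrite patchE indicE.
  by case: ifP => _; rewrite ?mul1e ?mul0e.
have ms := measurable_root_split s; have ma := measurable_root_alive s.
have md := measurable_root_dead s.
rewrite !indE -ge0_integralD//; [|exact: mind..].
rewrite -ge0_integralD//; [|by move=> w _; rewrite adde_ge0|by apply: emeasurable_funD; exact: mind|exact: mind].
apply: ae_eq_integral => //.
- exact: mind.
- by apply: emeasurable_funD; [apply: emeasurable_funD|]; exact: mind.
- apply: filterS ae_clocks_gt0 => w /(_ [::]) w0 _.
  rewrite -!ge0_muleDl ?adde_ge0 ?lee_fin//.
  by rewrite -!EFinD (root_cases s w0) indicT.
Qed.

End first_event.

Section integrability.
Local Open Scope ereal_scope.
Context {d : measure_display} {T : measurableType d} {R : realType}.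
Variables (P : probability T R) (lambda mu : R).
Variables S D : lineage -> {RV P >-> \bar R}.
Hypothesis SD_clocks : birth_death_clocks lambda mu S D.

Lemma pop_probE n t : \int[P]_w (pop_eq S D n t w)%:E = (pop_prob S D n t)%:E.
Proof.
rewrite fineK// ge0_fin_numE; last by apply: integral_ge0 => w _; rewrite lee_fin.
apply: (@le_lt_trans _ _ (\int[P]_w 1)).
  apply: ge0_le_integral => //; first by move=> w _; rewrite lee_fin.
  - by apply/measurable_EFinP; exact: measurable_pop_eq.
  - by move=> w _; rewrite lee_fin pop_eq_le1.
by rewrite integral_cst// mul1e (le_lt_trans (probability_le1 _ _))// ltry.
Qed.

Lemma pop_prob_ge0 n t : (0 <= pop_prob S D n t)%R.
Proof. by apply: fine_ge0; apply: integral_ge0 => w _; rewrite lee_fin. Qed.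

Lemma pop_prob_le1 n t : (pop_prob S D n t <= 1)%R.
Proof.
rewrite -lee_fin -pop_probE; apply: (@le_trans _ _ (\int[P]_w 1)).
  apply: ge0_le_integral => //; first by move=> w _; rewrite lee_fin.
  - by apply/measurable_EFinP; exact: measurable_pop_eq.
  - by move=> w _; rewrite lee_fin pop_eq_le1.
by rewrite integral_cst// mul1e probability_le1.
Qed.

Let measurable_recon_pop n s t :
  measurable_fun setT (fun w => recon S D s t w * (pop_eq S D n t w)%:E).
Proof.
apply: emeasurable_funM; first exact: measurable_recon.
by apply/measurable_EFinP; exact: measurable_pop_eq.
Qed.

Lemma recon_pop_ge0 n s t w : 0 <= recon S D s t w * (pop_eq S D n t w)%:E.
Proof. by rewrite mule_ge0 ?recon_ge0// lee_fin. Qed.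

Lemma integral_recon_le n s t :
  \int[P]_w (recon S D s t w * (pop_eq S D n t w)%:E) <= n%:R%:E.
Proof.
apply: (@le_trans _ _ (\int[P]_w (cst n%:R%:E w))); last first.
  by rewrite integral_cst// -[leRHS]mule1 lee_wpmul2l ?lee_fin// probability_le1.
apply: ae_ge0_le_integral => //.
- by move=> w _; exact: recon_pop_ge0.
- by move=> w _; rewrite lee_fin.
- apply: filterS (ae_clocks_gt0 SD_clocks) => w S0 _ /=.
  rewrite /pop_eq; case: eqP => [<-|_]; last by rewrite mule0 lee_fin.
  by rewrite mule1 recon_le.
Qed.

Lemma pop_reconE n s t :
  \int[P]_w (recon S D s t w * (pop_eq S D n t w)%:E) = (pop_recon S D n s t)%:E.
Proof.
rewrite fineK// ge0_fin_numE; last by apply: integral_ge0 => w _; exact: recon_pop_ge0.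
exact: le_lt_trans (integral_recon_le n s t) (ltry _).
Qed.

Lemma pop_recon_ge0 n s t : (0 <= pop_recon S D n s t)%R.
Proof. by apply: fine_ge0; apply: integral_ge0 => w _; exact: recon_pop_ge0. Qed.

Lemma pop_recon_le n s t : (pop_recon S D n s t <= n%:R)%R.
Proof. by rewrite -lee_fin -pop_reconE integral_recon_le. Qed.

End integrability.

(** * Renewal equations *)

Section convolution.
Local Open Scope ereal_scope.
Context {d : measure_display} {T : measurableType d} {R : realType}.
Variables (P : probability T R) (lambda mu : R).
Variables S D : lineage -> {RV P >-> \bar R}.
Hypothesis lambda_gt0 : (0 < lambda)%R.
Hypothesis SD_clocks : birth_death_clocks lambda mu S D.

Let leb := @lebesgue_measure R.
Let k (x : R) : R := lambda * expR (- (lambda + mu) * x).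
Let Sb b := subtree b S.
Let Db b := subtree b D.
Let pop b n x := pop_prob (Sb b) (Db b) n x.
Let rec b n x y := pop_recon (Sb b) (Db b) n x y.

Let mS u : measurable_fun setT (S u). Proof. exact: measurable_funPT. Qed.
Let mD u : measurable_fun setT (D u). Proof. exact: measurable_funPT. Qed.

Lemma pop_eq_split n s t w : root_split S D s w -> (s <= t)%R ->
  pop_eq S D n t w = (\sum_(j < n.+1)
    pop_eq (Sb false) (Db false) j (t - fine (S [::] w)) w *
    pop_eq (Sb true) (Db true) (n - j) (t - fine (S [::] w)) w)%R.
Proof.
move=> [S0 SD Ss] st.
have Sfin : S [::] w = (fine (S [::] w))%:E.
  by rewrite fineK// ge0_fin_numE ?ltW// (le_lt_trans Ss)// ltry.
rewrite {1}/pop_eq (@recon_split _ _ _ _ _ _ _ _ Sfin) -?Sfin//.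
  by apply: convolution_nat; exact: recon_nat.
by rewrite (le_trans _ st)// -lee_fin -Sfin.
Qed.

Lemma recon_split_root s t w : root_split S D s w ->
  recon S D s t w =
    recon (Sb false) (Db false) (s - fine (S [::] w)) (t - fine (S [::] w)) w +
    recon (Sb true) (Db true) (s - fine (S [::] w)) (t - fine (S [::] w)) w.
Proof.
move=> [S0 SD Ss].
have Sfin : S [::] w = (fine (S [::] w))%:E.
  by rewrite fineK// ge0_fin_numE ?ltW// (le_lt_trans Ss)// ltry.
by rewrite (@recon_split _ _ _ _ _ _ _ _ Sfin) -?Sfin// -lee_fin -Sfin.
Qed.

Let msub (s : R) : measurable_fun setT (fun x : R => s - x)%R.
Proof. exact: measurable_funB. Qed.

Let clocksTb b := clocksT S D (subtree_index b).

Let mSb b u : measurable_fun setT (fun z : measurableTypeR R * clocksTb b => Sb b u z.2).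
Proof.
have m : measurable_fun setT (Sb b u : clocksTb b -> \bar R).
  by apply: (@measurable_clocksT _ _ _ _ S D (subtree_index b) (inl (rcons u b))); exists u; left.
exact: (measurableT_comp m measurable_snd).
Qed.

Let mDb b u : measurable_fun setT (fun z : measurableTypeR R * clocksTb b => Db b u z.2).
Proof.
have m : measurable_fun setT (Db b u : clocksTb b -> \bar R).
  by apply: (@measurable_clocksT _ _ _ _ S D (subtree_index b) (inr (rcons u b))); exists u; right.
exact: (measurableT_comp m measurable_snd).
Qed.

Let msub1 b (s : R) : measurable_fun setT (fun z : measurableTypeR R * clocksTb b => s - z.1)%R.
Proof. exact: (measurableT_comp (msub s) measurable_fst). Qed.

Let mpop b n t : measurable_fun setT
  (fun z : measurableTypeR R * clocksTb b => (pop_eq (Sb b) (Db b) n (t - z.1) z.2)%:E).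
Proof.
apply/measurable_EFinP.
rewrite (_ : (fun z => _) = fun z : measurableTypeR R * clocksTb b =>
  pop_eq (fun u z => Sb b u z.2) (fun u z => Db b u z.2) n (t - z.1) z); last first.
  by apply/funext => z; rewrite -(pop_eq_comp (Sb b) (Db b) snd).
by apply: measurable_pop_eq; [exact: mSb|exact: mDb|exact: msub1].
Qed.

Let mrec b n s t : measurable_fun setT
  (fun z : measurableTypeR R * clocksTb b => recon (Sb b) (Db b) (s - z.1) (t - z.1) z.2 *
     (pop_eq (Sb b) (Db b) n (t - z.1) z.2)%:E).
Proof.
apply: emeasurable_funM; last exact: mpop.
rewrite (_ : (fun z => _) = fun z : measurableTypeR R * clocksTb b =>
  recon (fun u z => Sb b u z.2) (fun u z => Db b u z.2) (s - z.1) (t - z.1) z); last first.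
  by apply/funext => z; rewrite -(recon_comp (Sb b) (Db b) snd).
by apply: measurable_recon; [exact: mSb|exact: mDb|exact: msub1|exact: msub1].
Qed.

Let mpopx b n t : measurable_fun setT (fun x : R => pop b n (t - x)%R).
Proof. exact: (measurable_pop_prob (Sb b) (Db b) n (msub t)). Qed.

Let mrecx b n s t : measurable_fun setT (fun x : R => rec b n (s - x)%R (t - x)%R).
Proof. exact: (measurable_pop_recon (Sb b) (Db b) n (msub s) (msub t)). Qed.

Let mk : measurable_fun setT k.
Proof.
by apply: measurable_funM => //; apply: measurableT_comp.
Qed.

Let k_ge0 x : (0 <= k x)%R.
Proof. by rewrite mulr_ge0 ?expR_ge0// ltW. Qed.

Let pop_ge0 b n x : (0 <= pop b n x)%R. Proof. exact: pop_prob_ge0. Qed.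
Let rec_ge0 b n x y : (0 <= rec b n x y)%R. Proof. exact: pop_recon_ge0. Qed.

Lemma integral_split_pop n s t : (s <= t)%R ->
  \int[P]_(w in root_split S D s) (pop_eq S D n t w)%:E =
  \int[leb]_(x in `]0%R, s])
    (k x * \sum_(j < n.+1) pop false j (t - x) * pop true (n - j) (t - x))%:E.
Proof.
move=> st; have mrs := measurable_root_split S D s.
transitivity (\int[P]_(w in root_split S D s) (\sum_(j < n.+1)
    ((pop_eq (Sb false) (Db false) j (t - fine (S [::] w)) w)%:E *
     (pop_eq (Sb true) (Db true) (n - j) (t - fine (S [::] w)) w)%:E))).
  apply: eq_integral => w /set_mem ws; rewrite (pop_eq_split n ws st) -sumEFin.
  by apply: eq_bigr => j _; rewrite EFinM.
have mSfine : measurable_fun setT (fun w => t - fine (S [::] w))%R.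
  apply: measurable_funB => //.
  exact: (measurableT_comp (@fine_measurable R setT measurableT)).
have mpw b j : measurable_fun setT (fun w => (pop_eq (Sb b) (Db b) j (t - fine (S [::] w)) w)%:E).
  apply/measurable_EFinP.
  exact: measurable_pop_eq.
rewrite ge0_integral_sum//; last first.
- by move=> j w _; rewrite mule_ge0// lee_fin.
- by move=> j; apply: measurable_funTS; apply: emeasurable_funM.
transitivity (\int[leb]_(x in `]0%R, s]) (\sum_(j < n.+1)
   (k x * (pop false j (t - x) * pop true (n - j) (t - x)))%:E)); last first.
  by apply: eq_integral => x _; rewrite sumEFin mulr_sumr.
rewrite ge0_integral_sum//; last first.
- by move=> j x _; rewrite lee_fin mulr_ge0// mulr_ge0.
- move=> j; apply: measurable_funTS; apply/measurable_EFinP.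
  exact: (measurable_funM mk (measurable_funM (mpopx false j t) (mpopx true (n - j)%N t))).
apply: eq_bigr => j _.
have := branch_integral lambda_gt0 SD_clocks s (@mpop false j t) (@mpop true (n - j)%N t).
rewrite /= => ->//; last 2 first.
- by move=> z; rewrite lee_fin.
- by move=> z; rewrite lee_fin.
by apply: eq_integral => x _; rewrite !pop_probE -!EFinM.
Qed.

(** M is the sum of the counts of the two subtrees. Each count is grouped with the population
    indicator of its own subtree, so that the indicator of the other subtree is an independent
    factor. *)
Lemma integral_split_recon n s t : (s <= t)%R ->
  \int[P]_(w in root_split S D s) (recon S D s t w * (pop_eq S D n t w)%:E) =
  \int[leb]_(x in `]0%R, s])
    (k x * \sum_(j < n.+1) (rec false j (s - x) (t - x) * pop true (n - j) (t - x) +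
                            pop false j (t - x) * rec true (n - j) (s - x) (t - x)))%:E.
Proof.
move=> st; have mrs := measurable_root_split S D s.
pose p b j w := (pop_eq (Sb b) (Db b) j (t - fine (S [::] w)) w)%:E.
pose r b w := recon (Sb b) (Db b) (s - fine (S [::] w)) (t - fine (S [::] w)) w.
have p0 b j w : 0 <= p b j w by rewrite lee_fin.
have r0 b w : 0 <= r b w by exact: recon_ge0.
transitivity (\int[P]_(w in root_split S D s) (\sum_(j < n.+1)
    (r false w * p false j w * p true (n - j)%N w + p false j w * (r true w * p true (n - j)%N w)))).
  apply: eq_integral => w /set_mem ws.
  rewrite (pop_eq_split n ws st) (recon_split_root t ws) -sumEFin.
  rewrite ge0_sume_distrr => [|j _]; last by rewrite lee_fin mulr_ge0.
  apply: eq_bigr => j _; rewrite EFinM ge0_muleDl ?recon_ge0//.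
  by rewrite -/(p false j w) -/(p true (n - j)%N w) -/(r false w) -/(r true w) !muleA (muleC (p false j w)).
have mSfine a : measurable_fun setT (fun w => a - fine (S [::] w))%R.
  apply: measurable_funB => //.
  exact: (measurableT_comp (@fine_measurable R setT measurableT)).
have mpw b j : measurable_fun setT (p b j).
  apply/measurable_EFinP.
  exact: measurable_pop_eq.
have mrw b : measurable_fun setT (r b).
  exact: measurable_recon.
rewrite ge0_integral_sum//; last first.
- by move=> j w _; rewrite adde_ge0// !mule_ge0.
- move=> j; apply: measurable_funTS; apply: emeasurable_funD; apply: emeasurable_funM => //;
    exact: emeasurable_funM.
transitivity (\int[leb]_(x in `]0%R, s]) (\sum_(j < n.+1)
   (k x * (rec false j (s - x) (t - x) * pop true (n - j) (t - x) +
           pop false j (t - x) * rec true (n - j) (s - x) (t - x)))%:E)); last first.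
  by apply: eq_integral => x _; rewrite sumEFin mulr_sumr.
rewrite ge0_integral_sum//; last first.
- by move=> j x _; rewrite lee_fin mulr_ge0// addr_ge0// mulr_ge0.
- move=> j; apply: measurable_funTS; apply/measurable_EFinP.
  exact: (measurable_funM mk (measurable_funD
    (measurable_funM (mrecx false j s t) (mpopx true (n - j)%N t))
    (measurable_funM (mpopx false j t) (mrecx true (n - j)%N s t)))).
apply: eq_bigr => j _.
rewrite ge0_integralD//; first last.
- by apply: measurable_funTS; apply: emeasurable_funM => //; exact: emeasurable_funM.
- by move=> w _; rewrite !mule_ge0.
- by apply: measurable_funTS; apply: emeasurable_funM => //; exact: emeasurable_funM.
- by move=> w _; rewrite !mule_ge0.
have r1 : measurable_fun setT
    (fun x : R => k x * (rec false j (s - x) (t - x) * pop true (n - j) (t - x)))%R.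
  exact: (measurable_funM mk (measurable_funM (mrecx false j s t) (mpopx true (n - j)%N t))).
have r2 : measurable_fun setT
    (fun x : R => k x * (pop false j (t - x) * rec true (n - j) (s - x) (t - x)))%R.
  exact: (measurable_funM mk (measurable_funM (mpopx false j t) (mrecx true (n - j)%N s t))).
transitivity (\int[leb]_(x in `]0%R, s])
    (k x * (rec false j (s - x) (t - x) * pop true (n - j) (t - x)))%:E +
  \int[leb]_(x in `]0%R, s])
    (k x * (pop false j (t - x) * rec true (n - j) (s - x) (t - x)))%:E).
  congr (_ + _).
    have := branch_integral lambda_gt0 SD_clocks s (@mrec false j s t) (@mpop true (n - j)%N t).
    rewrite /= => ->//.
    + apply: eq_integral => x _.
      by rewrite pop_probE (pop_reconE (birth_death_clocks_subtree false SD_clocks)) -!EFinM.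
    + by move=> z; rewrite mule_ge0 ?recon_ge0 ?lee_fin.
    + by move=> z; rewrite lee_fin.
  have := branch_integral lambda_gt0 SD_clocks s (@mpop false j t) (@mrec true (n - j)%N s t).
  rewrite /= => ->//.
  + apply: eq_integral => x _.
    by rewrite pop_probE (pop_reconE (birth_death_clocks_subtree true SD_clocks)) -!EFinM.
  + by move=> z; rewrite lee_fin.
  + by move=> z; rewrite mule_ge0 ?recon_ge0 ?lee_fin.
rewrite -ge0_integralD//; first last.
- by apply: measurable_funTS; apply/measurable_EFinP; exact: r2.
- by move=> x _; rewrite lee_fin mulr_ge0// mulr_ge0.
- by apply: measurable_funTS; apply/measurable_EFinP; exact: r1.
- by move=> x _; rewrite lee_fin mulr_ge0// mulr_ge0.
by apply: eq_integral => x _; rewrite -EFinD -mulrDr.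
Qed.

End convolution.

Lemma integrable_bounded_itv {R : realType} (f : R -> R) (s M : R) :
  measurable_fun setT f -> (forall x, 0 < x <= s -> `|f x| <= M) ->
  (@lebesgue_measure R).-integrable `]0, s] (EFin \o f).
Proof.
move=> mf fM; apply: measurable_bounded_integrable => //.
- have [s0|s0] := ltP 0 s.
    by rewrite /= lebesgue_measure_itv/= lte_fin s0 -EFinD ltry.
  by rewrite set_itv_ge ?measure0// bnd_simp -leNgt.
- exact: measurable_funTS.
- exists M; split => [|y My x /=]; first exact: num_real.
  by rewrite in_itv/= => x0s; rewrite (le_trans (fM _ x0s))// ltW.
Qed.

Section renewal.
Context {d : measure_display} {T : measurableType d} {R : realType}.
Variables (P : probability T R) (lambda mu : R).
Variables S D : lineage -> {RV P >-> \bar R}.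
Hypothesis lambda_gt0 : 0 < lambda.
Hypothesis mu_ge0 : 0 <= mu.
Hypothesis SD_clocks : birth_death_clocks lambda mu S D.

Let leb := @lebesgue_measure R.
Let k (x : R) : R := lambda * expR (- (lambda + mu) * x).
Let pop b n x := pop_prob (subtree b S) (subtree b D) n x.
Let rec b n x y := pop_recon (subtree b S) (subtree b D) n x y.

Let conv_pop n t x := k x * \sum_(j < n.+1) pop false j (t - x) * pop true (n - j) (t - x).
Let conv_recon n s t x :=
  k x * \sum_(j < n.+1) (rec false j (s - x) (t - x) * pop true (n - j) (t - x) +
                         pop false j (t - x) * rec true (n - j) (s - x) (t - x)).

Let mk : measurable_fun setT k.
Proof. by apply: measurable_funM => //; apply: measurableT_comp. Qed.

Let msub (s : R) : measurable_fun setT (fun x : R => s - x).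
Proof. exact: measurable_funB. Qed.

Lemma splitting_density_bounded x : 0 < x -> `|k x| <= lambda.
Proof.
move=> x0; rewrite ger0_norm; last by rewrite mulr_ge0 ?expR_ge0// ltW.
rewrite ler_piMr ?(ltW lambda_gt0)// -expR0 ler_expR mulNr oppr_le0.
by rewrite mulr_ge0 ?(ltW x0)// addr_ge0// ltW.
Qed.

Let mpop b n t : measurable_fun setT (fun x : R => pop b n (t - x)).
Proof. exact: (measurable_pop_prob (subtree b S) (subtree b D) n (msub t)). Qed.

Let mrec b n s t : measurable_fun setT (fun x : R => rec b n (s - x) (t - x)).
Proof. exact: (measurable_pop_recon (subtree b S) (subtree b D) n (msub s) (msub t)). Qed.

Lemma measurable_conv_pop n t : measurable_fun setT (conv_pop n t).
Proof.
apply: measurable_funM => //; apply: measurable_sum => j.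
exact: measurable_funM.
Qed.

Lemma measurable_conv_recon n s t : measurable_fun setT (conv_recon n s t).
Proof.
apply: measurable_funM => //; apply: measurable_sum => j.
by apply: measurable_funD; exact: measurable_funM.
Qed.

Lemma integrable_conv_pop n s t :
  leb.-integrable `]0, s] (EFin \o conv_pop n t).
Proof.
apply: (@integrable_bounded_itv _ _ _ (lambda * \sum_(j < n.+1) 1)).
  exact: measurable_conv_pop.
move=> x /andP[x0 _]; rewrite normrM ler_pM//; first exact: splitting_density_bounded.
apply: le_trans (ler_norm_sum _ _ _) _; apply: ler_sum => j _.
rewrite ger0_norm ?mulr_ge0 ?pop_prob_ge0//.
by rewrite mulr_ile1 ?pop_prob_ge0 ?pop_prob_le1.
Qed.

Lemma integrable_conv_recon n s t :
  leb.-integrable `]0, s] (EFin \o conv_recon n s t).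
Proof.
have clb b := birth_death_clocks_subtree b SD_clocks.
apply: (@integrable_bounded_itv _ _ _ (lambda * \sum_(j < n.+1) n%:R)).
  exact: measurable_conv_recon.
move=> x /andP[x0 _]; rewrite normrM ler_pM//; first exact: splitting_density_bounded.
apply: le_trans (ler_norm_sum _ _ _) _; apply: ler_sum => j _.
have jn : (j <= n)%N by rewrite -ltnS.
rewrite ger0_norm; last by rewrite addr_ge0// mulr_ge0 ?pop_prob_ge0 ?pop_recon_ge0.
(* The two products are at most j and n - j, since each count is bounded by the population of its
   subtree. *)
rewrite -[in leRHS](subnKC jn) natrD lerD//.
  by rewrite -[leRHS]mulr1 ler_pM ?pop_prob_ge0 ?pop_recon_ge0 ?pop_prob_le1// (pop_recon_le (clb _)).
by rewrite -[leRHS]mul1r ler_pM ?pop_prob_ge0 ?pop_recon_ge0 ?pop_prob_le1// (pop_recon_le (clb _)).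
Qed.

Lemma integrable_splitting_density s : leb.-integrable `]0, s] (EFin \o k).
Proof.
apply: (@integrable_bounded_itv _ _ _ lambda) => // x /andP[x0 _].
exact: splitting_density_bounded.
Qed.

Let intE (f : R -> R) s : leb.-integrable `]0, s] (EFin \o f) ->
  (\int[leb]_(x in `]0%R, s]) (f x)%:E = (\int[leb]_(x in `]0, s]) f x)%:E)%E.
Proof. by move=> fi; rewrite fineK//; exact: integrable_fin_num. Qed.

(** Computed as the complement of splitting and survival, which avoids a density for the death
    clock; that clock may be infinite. *)
Lemma root_dead_prob s : 0 <= s ->
  (P (root_dead S D s) = (1 - expR (- (lambda + mu) * s) -
    \int[leb]_(x in `]0, s]) k x)%:E)%E.
Proof.
move=> s0; have := integral_root_cases SD_clocks s (f := cst 1%E).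
move=> /(_ (measurable_cst _) (fun=> lee01)) /=.
rewrite !integral_cst ?mul1e//; last 3 first.
- exact: measurable_root_dead.
- exact: measurable_root_alive.
- exact: measurable_root_split.
move=> E.
have I1 : (\int[P]_w 1 = 1)%E by rewrite integral_cst// mul1e; exact: probability_setT.
have splitE : (P (root_split S D s) = (\int[leb]_(x in `]0, s]) k x)%:E)%E.
  have := branch_integral lambda_gt0 SD_clocks s (h0 := cst 1%E) (h1 := cst 1%E).
  move=> /(_ (measurable_cst _) (measurable_cst _) (fun=> lee01) (fun=> lee01)) /=.
  rewrite mule1 integral_cst ?mul1e; last exact: measurable_root_split.
  move=> Es; rewrite -intE; last exact: integrable_splitting_density.
  by rewrite [LHS]Es; apply: eq_integral => x _; rewrite I1 !mule1.
have aliveE := root_alive_prob SD_clocks s0.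
have dfin : P (root_dead S D s) \is a fin_num.
  by apply: fin_num_measure; exact: measurable_root_dead.
have : (1 = P (root_split S D s) + P (root_alive S D s) + P (root_dead S D s))%E 
  by rewrite -[LHS](@probability_setT _ _ _ P); exact: E.
rewrite splitE aliveE -(fineK dfin) -!EFinD => -[E1]; congr EFin.
by rewrite E1; ring.
Qed.

Lemma pop_eq_root_alive n s w : 0 <= s -> (forall u, 0 < S u w)%E ->
  root_alive S D s w -> pop_eq S D n s w = (n == 1)%:R.
Proof.
move=> s0 Spos sa; rewrite /pop_eq (recon_root_alive Spos s0 sa).
  by rewrite eqe eq_sym -[1](mulr1n 1) eqr_nat.
by exists [::]; apply/alive_nil.
Qed.

Lemma pop_eq_root_dead n s t w : s <= t -> root_dead S D s w ->
  pop_eq S D n t w = (n == 0)%:R.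
Proof.
move=> st [DS Ds]; rewrite /pop_eq recon_dead//; last first.
  by rewrite (le_trans Ds)// lee_fin.
by rewrite eqe eq_sym -[0](mulr0n 1) eqr_nat.
Qed.

Lemma recon_pop_root_alive n s t w : (0 < n)%N -> 0 <= s -> (forall u, 0 < S u w)%E ->
  root_alive S D s w ->
  (recon S D s t w * (pop_eq S D n t w)%:E = (pop_eq S D n t w)%:E)%E.
Proof.
move=> n0 s0 Spos sa; rewrite /pop_eq; case: eqP => [tn|_]; last by rewrite mule0.
rewrite (recon_root_alive Spos s0 sa) ?mule1//.
by apply: (@recon_neq0 _ _ _ _ _ t); rewrite tn eqe pnatr_eq0 -lt0n.
Qed.

Lemma renewal_pop n s : 0 <= s ->
  pop_prob S D n s = \int[leb]_(x in `]0, s]) conv_pop n s x +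
    (n == 1)%:R * expR (- (lambda + mu) * s) +
    (n == 0)%:R * (1 - expR (- (lambda + mu) * s) - \int[leb]_(x in `]0, s]) k x).
Proof.
move=> s0; apply: EFin_inj.
have ma := measurable_root_alive S D s; have md := measurable_root_dead S D s.
have mpe : measurable_fun setT (fun w => (pop_eq S D n s w)%:E).
  by apply/measurable_EFinP; apply: measurable_pop_eq.
rewrite -pop_probE (integral_root_cases SD_clocks s)// ?(integral_split_pop lambda_gt0 SD_clocks)//.
rewrite !EFinD; congr (_ + _ + _)%E.
- by rewrite intE//; exact: integrable_conv_pop.
- transitivity (\int[P]_(w in root_alive S D s) (n == 1)%:R%:E)%E.
    apply: ae_eq_integral => //; [exact: measurable_funTS|].
    apply: filterS (ae_clocks_gt0 SD_clocks) => w Spos sa.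
    by rewrite pop_eq_root_alive.
  by rewrite integral_cst// [X in (_ * X)%E](root_alive_prob SD_clocks).
- transitivity (\int[P]_(w in root_dead S D s) (n == 0)%:R%:E)%E.
    by apply: eq_integral => w /set_mem sd; rewrite (@pop_eq_root_dead _ s).
  by rewrite integral_cst// [X in (_ * X)%E]root_dead_prob.
- by move=> w; rewrite lee_fin.
Qed.

(** If the root is alive at s then M = 1 on N_t = n, so this contribution [a] is the same as in the
    decomposition of P(N_t = n) at time s. It is eliminated between the two decompositions instead
    of being computed. A root dead by s contributes nothing because n > 0. *)
Lemma renewal_recon n s t : (0 < n)%N -> 0 <= s <= t ->
  pop_recon S D n s t = pop_prob S D n t +
    \int[leb]_(x in `]0, s]) conv_recon n s t x -
    \int[leb]_(x in `]0, s]) conv_pop n t x.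
Proof.
move=> n0 /andP[s0 st].
have ma := measurable_root_alive S D s; have md := measurable_root_dead S D s.
have mpe : measurable_fun setT (fun w => (pop_eq S D n t w)%:E).
  by apply/measurable_EFinP; apply: measurable_pop_eq.
have mre : measurable_fun setT (fun w => recon S D s t w * (pop_eq S D n t w)%:E)%E.
  by apply: emeasurable_funM => //; apply: measurable_recon.
set a := (\int[P]_(w in root_alive S D s) (pop_eq S D n t w)%:E)%E.
have dead0 : (\int[P]_(w in root_dead S D s) (pop_eq S D n t w)%:E = 0)%E.
  apply: integral0_eq => w wd; rewrite (@pop_eq_root_dead _ s)//.
  by rewrite (gtn_eqF n0).
have popE : ((pop_prob S D n t)%:E = (\int[leb]_(x in `]0, s]) conv_pop n t x)%:E + a)%E.
  rewrite -pop_probE (integral_root_cases SD_clocks s)//; last by move=> w; rewrite lee_fin.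
  rewrite dead0 adde0.
  rewrite (integral_split_pop lambda_gt0 SD_clocks)// -/a; congr (_ + _)%E.
  by rewrite intE//; exact: integrable_conv_pop.
have reconE : ((pop_recon S D n s t)%:E = (\int[leb]_(x in `]0, s]) conv_recon n s t x)%:E + a)%E.
  rewrite -(pop_reconE SD_clocks) (integral_root_cases SD_clocks s)//; last first.
    by move=> w; exact: recon_pop_ge0.
  rewrite [X in (_ + X)%E]integral0_eq ?adde0; last first.
    move=> w wd; rewrite (@pop_eq_root_dead _ s)//.
    by rewrite (gtn_eqF n0) mule0.
  congr (_ + _)%E.
    rewrite (integral_split_recon lambda_gt0 SD_clocks)//.
    by rewrite intE//; exact: integrable_conv_recon.
  apply: ae_eq_integral => //; [exact: measurable_funTS|exact: measurable_funTS|].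
  apply: filterS (ae_clocks_gt0 SD_clocks) => w Spos sa.
  by rewrite recon_pop_root_alive.
have afin : a \is a fin_num.
  have : ((pop_prob S D n t)%:E \is a fin_num)%E by [].
  by rewrite popE fin_numD => /andP[].
move: popE reconE; rewrite -(fineK afin) -!EFinD => -[->] [->].
by ring.
Qed.

End renewal.

(** * Volterra equations *)

Section real_analysis.
Context {R : realType}.
Let leb := @lebesgue_measure R.

Lemma integrable_derivable (f : R -> R) (s : R) :
  (forall x, 0 <= x <= s -> derivable f x 1) ->
  leb.-integrable `]0, s] (EFin \o f).
Proof.
move=> df.
have cf : {within `[0, s], continuous f}.
  by apply: derivable_within_continuous => x; rewrite in_itv/=; exact: df.
have fi : leb.-integrable `[0, s] (EFin \o f).
  by apply: continuous_compact_integrable => //; exact: segment_compact.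
by apply: integrableS fi => //; apply: subset_itvr; rewrite bnd_simp.
Qed.

Lemma Rintegral_derive (F f : R -> R) (s : R) : 0 <= s ->
  (forall x, 0 <= x <= s -> is_derive x 1 F (f x)) ->
  (forall x, 0 <= x <= s -> derivable f x 1) ->
  \int[leb]_(x in `]0, s]) f x = F s - F 0.
Proof.
move=> s0 dF df.
have [->|s_neq0] := eqVneq s 0.
  by rewrite set_itvoc0 Rintegral_set0 subrr.
have s_gt0 : 0 < s by rewrite lt_neqAle eq_sym s_neq0.
have cf : {within `[0, s], continuous f}.
  by apply: derivable_within_continuous => x; rewrite in_itv/=; exact: df.
have cF x : 0 <= x <= s -> {for x, continuous F}.
  by move=> /dF [/derivable1_diffP + _]; exact: differentiable_continuous.
rewrite Rintegral_itv_obnd_cbnd; last exact: integrable_derivable.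
rewrite /Rintegral (@continuous_FTC2 _ f F)//.
- split.
  + by move=> x; rewrite in_itv/= => /andP[/ltW x0 /ltW xs]; have [] := dF x; rewrite ?x0.
  + by apply: cvg_at_right_filter; apply: cF; rewrite lexx.
  + by apply: cvg_at_left_filter; apply: cF; rewrite lexx s0.
- move=> x; rewrite in_itv/= => /andP[/ltW x0 /ltW xs].
  by rewrite derive1E; have [] := dF x; rewrite ?x0.
Qed.

Lemma is_derive_mulr (f g : R -> R) (x a b : R) :
  is_derive x 1 f a -> is_derive x 1 g b ->
  is_derive x 1 (fun y => f y * g y) (a * g x + f x * b).
Proof.
move=> df dg; apply: is_derive_eq (is_deriveM df dg) _.
by rewrite addrC /GRing.scale /= [g x * a]mulrC.
Qed.

Lemma is_derive_cmulr (c : R) (f : R -> R) (x a : R) :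
  is_derive x 1 f a -> is_derive x 1 (fun y => c * f y) (c * a).
Proof.
move=> df; apply: is_derive_eq (is_derive_mulr (is_derive_cst c x 1) df) _.
by rewrite mul0r add0r.
Qed.

Lemma is_derive_exprn (f : R -> R) (n : nat) (x a : R) :
  is_derive x 1 f a -> is_derive x 1 (fun y => f y ^+ n) (n%:R * f x ^+ n.-1 * a).
Proof.
move=> df; have := is_deriveX n df.
by rewrite (_ : f ^+ n = fun y => f y ^+ n)//; apply/funext => y; rewrite fctE.
Qed.

Lemma is_derive_subl (f : R -> R) (t x a : R) :
  is_derive (t - x) 1 f a -> is_derive x 1 (fun y => f (t - y)) (- a).
Proof.
move=> df.
have dg : is_derive x 1 (fun y : R => t - y) (-1).
  apply: is_derive_eq (is_deriveB (is_derive_cst t x 1) (is_derive_id x 1)) _.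
  by rewrite add0r.
have := @is_derive1_comp R f (fun y => t - y) x _ _ df dg.
by rewrite mulrN1.
Qed.

Lemma is_derive_expRM (a x : R) :
  is_derive x 1 (fun y => expR (a * y)) (a * expR (a * x)).
Proof.
have dg := is_derive_cmulr a (is_derive_id x 1).
have := @is_derive1_comp R expR (fun y => a * y) x _ _ (is_derive_expR _) dg.
by rewrite mulr1 mulrC.
Qed.

(* The weight [expR (K * s)] turns a Volterra operator into a contraction once [K] is large. *)
Lemma Volterra_contraction (f g : R -> R) (s M K : R) : 0 < K -> 0 <= M -> 0 <= s ->
  leb.-integrable `]0, s] (EFin \o f) -> leb.-integrable `]0, s] (EFin \o g) ->
  (forall x, 0 < x <= s -> `|f x - g x| <= M * expR (K * (s - x))) ->
  `|\int[leb]_(x in `]0, s]) f x - \int[leb]_(x in `]0, s]) g x| <= M / K * expR (K * s).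
Proof.
move=> K0 M0 s0 fi gi fg; rewrite -RintegralB//.
have fgi : leb.-integrable `]0, s] (EFin \o (fun x => f x - g x)).
  by have := integrableB _ fi gi; exact.
pose h x := M * expR (K * s) * expR (- K * x).
have hE x : M * expR (K * (s - x)) = h x.
  by rewrite /h -mulrA -expRD; congr (_ * expR _); ring.
have dh (x : R) : is_derive x 1 (fun x : R => - (M / K * expR (K * s)) * expR (- K * x)) (h x).
  apply: is_derive_eq (is_derive_cmulr _ (is_derive_expRM (- K) x)) _.
  by rewrite /h; field; rewrite gt_eqF.
have hi : leb.-integrable `]0, s] (EFin \o h).
  apply: (@integrable_bounded_itv _ _ _ (M * expR (K * s))).
    by apply: measurable_funM => //; apply: measurableT_comp.
  move=> x /andP[x_gt0 _]; rewrite ger0_norm; last by rewrite !mulr_ge0 ?expR_ge0.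
  rewrite /h ler_piMr ?mulr_ge0 ?expR_ge0// -expR0 ler_expR mulNr oppr_le0.
  by rewrite mulr_ge0// ltW.
apply: le_trans (le_normr_Rintegral _ _) _ => //.
apply: (@le_trans _ _ (\int[leb]_(x in `]0, s]) h x)).
  apply: le_Rintegral => //.
    by have := integrable_norm fgi; apply: eq_integrable.
  by move=> x /=; rewrite in_itv/= => /fg; rewrite hE.
rewrite (Rintegral_derive s0 (fun x _ => dh x)); last first.
  by move=> x _; exact: ex_derive.
rewrite mulr0 expR0 mulr1 opprK gerDr mulNr oppr_le0.
by rewrite !mulr_ge0 ?expR_ge0 ?invr_ge0// ltW.
Qed.

Lemma eq0_le_halves (a M : R) : (forall k, `|a| <= M / 2 ^+ k) -> a = 0.
Proof.
move=> aM; apply/eqP; apply/negPn/negP => a0.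
have na : 0 < `|a| by rewrite normr_gt0.
(* Since k > M / |a| and 2^k > k, the bound fails at this k. *)
pose k := (Num.truncn (M / `|a|)).+1.
have := aM k; rewrite ler_pdivlMr ?exprn_gt0// => /(le_trans _)H.
have : `|a| * k%:R <= M.
  by rewrite H// ler_wpM2l// -natrX ler_nat ltnW// ltn_expl.
by rewrite mulrC -ler_pdivlMr// leNgt truncnS_gt.
Qed.

End real_analysis.

(** * Explicit solutions *)

Section closed_forms.
Context {R : realType}.
Variables lambda mu : R.

(** For t >= 0 this has the sign of lambda - mu, hence does not vanish. *)
Definition bd_den (t : R) : R := lambda - mu * expR (- (lambda - mu) * t).
Definition bd_extinct (t : R) : R := mu * (1 - expR (- (lambda - mu) * t)) / bd_den t.
Definition bd_ratio (t : R) : R := lambda * (1 - expR (- (lambda - mu) * t)) / bd_den t.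
(** This is P(N_t = 1), equal to (1 - [bd_extinct]) (1 - [bd_ratio]) for t >= 0 and written here in
    a form convenient for differentiation. *)
Definition bd_one (t : R) : R :=
  (lambda - mu) ^+ 2 * expR (- (lambda - mu) * t) / bd_den t ^+ 2.

(* Kendall's modified geometric law of the population at time [t] *)
Definition pop_law (n : nat) (t : R) : R :=
  if n is m.+1 then bd_one t * bd_ratio t ^+ m else bd_extinct t.

(* [recon_law c n t - pop_law n t], where [recon_law] is the value of
   [E(M_{s,t}; N_t = n)] when [c = bd_ratio (t - s)] *)
Definition recon_excess (c : R) (n : nat) (t : R) : R :=
  if n is m.+1 then m%:R * bd_one t * (bd_ratio t - c) * bd_ratio t ^+ m.-1
  else - bd_extinct t.

Definition recon_law (c : R) (n : nat) (t : R) : R := pop_law n t + recon_excess c n t.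

Hypothesis lambda_gt0 : 0 < lambda.
Hypothesis mu_ge0 : 0 <= mu.
Hypothesis lambda_neq_mu : lambda != mu.

Let E (t : R) := expR (- (lambda - mu) * t).

Let delta_neq0 : lambda - mu != 0. Proof. by rewrite subr_eq0. Qed.

(** Both numerators share the sign of the denominator, in the supercritical and the subcritical
    regime alike (a zero numerator is allowed in the second). All later bounds rest on these two
    inequalities, so the regimes are separated only here. *)
Lemma bd_den_sign t : 0 <= t ->
  0 < (lambda - mu) / bd_den t /\ 0 <= (1 - E t) / bd_den t.
Proof.
move=> t0; have [lm|lm|/eqP] := ltgtP mu lambda; last by rewrite eq_sym (negbTE lambda_neq_mu).
- have E1 : E t <= 1.
    by rewrite -expR0 ler_expR mulNr oppr_le0 mulr_ge0// subr_ge0 ltW.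
  have L0 : 0 < bd_den t.
    by rewrite subr_gt0 (le_lt_trans _ lm)// ler_piMr.
  split; first by rewrite divr_gt0// subr_gt0.
  by rewrite divr_ge0 ?(ltW L0)// subr_ge0.
- have E1 : 1 <= E t.
    by rewrite -expR0 ler_expR opprB mulr_ge0// subr_ge0 ltW.
  have mu0 : 0 < mu by exact: lt_trans lm.
  have L0 : bd_den t < 0.
    by rewrite subr_lt0 (lt_le_trans lm)// ler_peMr ?(ltW mu0).
  rewrite -invr_lt0 in L0; split; first by rewrite nmulr_lgt0// subr_lt0.
  by rewrite nmulr_lge0// subr_le0.
Qed.

Lemma bd_den_neq0 t : 0 <= t -> bd_den t != 0.
Proof.
move=> /bd_den_sign[+ _]; apply: contraTneq => ->.
by rewrite invr0 mulr0 ltxx.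
Qed.

Lemma bd_extinctE t : bd_extinct t = mu / lambda * bd_ratio t.
Proof. by rewrite /bd_extinct /bd_ratio !mulrA divfK// gt_eqF. Qed.

Lemma bd_ratio_ge0 t : 0 <= t -> 0 <= bd_ratio t.
Proof. by move=> /bd_den_sign[_ ?]; rewrite /bd_ratio -mulrA mulr_ge0// ltW. Qed.

Lemma bd_extinct_ge0 t : 0 <= t -> 0 <= bd_extinct t.
Proof. by move=> t0; rewrite bd_extinctE mulr_ge0 ?bd_ratio_ge0// divr_ge0// ltW. Qed.

Lemma onem_bd_extinct t : 0 <= t -> 1 - bd_extinct t = (lambda - mu) / bd_den t.
Proof.
move=> /bd_den_neq0 L0; apply: (mulIf L0); rewrite mulfVK// mulrBl mulfVK//.
by rewrite /bd_den; ring.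
Qed.

Lemma onem_bd_ratio t : 0 <= t -> 1 - bd_ratio t = (lambda - mu) / bd_den t * E t.
Proof.
move=> /bd_den_neq0 L0; apply: (mulIf L0); rewrite mulrAC mulfVK// mulrBl mulfVK//.
by rewrite /bd_den /E; ring.
Qed.

Lemma bd_oneE t : 0 <= t -> bd_one t = (1 - bd_extinct t) * (1 - bd_ratio t).
Proof.
move=> t0; rewrite onem_bd_extinct// onem_bd_ratio// /bd_one -/(E t).
by field; exact: bd_den_neq0.
Qed.

Lemma bd_extinct_le1 t : 0 <= t -> bd_extinct t <= 1.
Proof. by move=> t0; rewrite -subr_ge0 onem_bd_extinct// ltW//; case: (bd_den_sign t0). Qed.

Lemma bd_ratio_le1 t : 0 <= t -> bd_ratio t <= 1.
Proof.
move=> t0; rewrite -subr_ge0 onem_bd_ratio// mulr_ge0 ?expR_ge0// ltW//.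
by case: (bd_den_sign t0).
Qed.

Lemma bd_one_ge0 t : 0 <= t -> 0 <= bd_one t.
Proof. by move=> t0; rewrite bd_oneE// mulr_ge0// subr_ge0 ?bd_extinct_le1 ?bd_ratio_le1. Qed.

Lemma bd_one_le1 t : 0 <= t -> bd_one t <= 1.
Proof.
move=> t0; rewrite bd_oneE// mulr_ile1 ?subr_ge0 ?bd_extinct_le1 ?bd_ratio_le1//.
- by rewrite lerBlDr lerDl bd_extinct_ge0.
- by rewrite lerBlDr lerDl bd_ratio_ge0.
Qed.

Lemma bd_one_gt0 t : 0 <= t -> 0 < bd_one t.
Proof.
move=> t0; rewrite bd_oneE// onem_bd_extinct// onem_bd_ratio//.
by have [L0 _] := bd_den_sign t0; rewrite mulr_gt0// mulr_gt0// expR_gt0.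
Qed.

Lemma bd_ratio_gt0 t : 0 < t -> 0 < bd_ratio t.
Proof.
move=> t0; rewrite lt_neqAle bd_ratio_ge0 ?(ltW t0)// andbT eq_sym.
have E1 : 1 - E t != 0.
  rewrite subr_eq0 eq_sym -expR0 (inj_eq (@expR_inj R)) mulf_neq0 ?oppr_eq0//.
  by rewrite gt_eqF.
apply: mulf_neq0; first by apply: mulf_neq0 => //; rewrite gt_eqF.
by rewrite invr_eq0 bd_den_neq0// ltW.
Qed.

Lemma pop_law_ge0 n t : 0 <= t -> 0 <= pop_law n t.
Proof.
move=> t0; case: n => [|m] /=; first exact: bd_extinct_ge0.
by rewrite mulr_ge0 ?bd_one_ge0// exprn_ge0// bd_ratio_ge0.
Qed.

Lemma pop_law_le1 n t : 0 <= t -> pop_law n t <= 1.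
Proof.
move=> t0; case: n => [|m] /=; first exact: bd_extinct_le1.
by rewrite mulr_ile1 ?bd_one_ge0 ?bd_one_le1 ?exprn_ge0 ?exprn_ile1 ?bd_ratio_ge0 ?bd_ratio_le1.
Qed.

Lemma pop_law0 n : pop_law n 0 = (n == 1)%:R.
Proof.
rewrite /pop_law /bd_one /bd_ratio /bd_extinct /bd_den mulr0 expR0 subrr !mulr0 !mul0r !mulr1.
case: n => [|[|m]] //; last by rewrite expr0n mulr0.
by rewrite ?expr0 ?mulr1 divff// expf_neq0.
Qed.

(** Supplies the starting estimate of the iteration in [pop_reconP]: the law is at most 1 and the
    excess at most n - 1 in absolute value. *)
Lemma recon_law_bound c n t : 0 <= c <= 1 -> 0 <= t -> `|recon_law c n t| <= n%:R.
Proof.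
move=> /andP[c0 c1] t0; rewrite /recon_law; case: n => [|m] /=; first by rewrite subrr normr0.
have q0 := bd_one_ge0 t0; have q1 := bd_one_le1 t0.
have e0 := bd_ratio_ge0 t0; have e1 := bd_ratio_le1 t0.
move: (bd_one t) (bd_ratio t) q0 q1 e0 e1 => q e q0 q1 e0 e1.
rewrite (le_trans (ler_normD _ _))// -nat1r lerD//.
  rewrite ger0_norm; last by rewrite mulr_ge0// exprn_ge0.
  by apply: mulr_ile1 => //; [exact: exprn_ge0|exact: exprn_ile1].
rewrite -!mulrA normrM normr_nat; apply: ler_piMr => //; rewrite normrM (ger0_norm q0).
apply: mulr_ile1 => //; rewrite normrM; apply: mulr_ile1 => //.
  by rewrite ler_norml; lra.
by rewrite ger0_norm ?exprn_ge0// exprn_ile1.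
Qed.

Let dE (t : R) : is_derive t 1 E (- (lambda - mu) * E t).
Proof. exact: is_derive_expRM. Qed.

Let d1E (c t : R) : is_derive t 1 (fun y : R => c * (1 - E y)) (c * ((lambda - mu) * E t)).
Proof.
apply: is_derive_cmulr.
apply: is_derive_eq (is_deriveB (is_derive_cst (1 : R) t 1) (dE t)) _.
by rewrite add0r mulNr opprK.
Qed.

Let dVden (t : R) : 0 <= t ->
  is_derive t 1 (fun y : R => (bd_den y)^-1) (- (mu * ((lambda - mu) * E t)) / bd_den t ^+ 2).
Proof.
move=> /bd_den_neq0 L0.
have dL : is_derive t 1 bd_den (mu * ((lambda - mu) * E t)).
  apply: is_derive_eq (is_deriveB (is_derive_cst lambda t 1) (is_derive_cmulr mu (dE t))) _.
  by rewrite add0r mulNr mulrN opprK.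
apply: is_derive_eq (is_deriveV L0 dL) _.
by rewrite /GRing.scale /= mulNr mulrC mulNr.
Qed.

Lemma is_derive_bd_ratio (t : R) : 0 <= t -> is_derive t 1 bd_ratio (lambda * bd_one t).
Proof.
move=> t0; apply: is_derive_eq (is_derive_mulr (d1E lambda t) (dVden t0)) _.
have L0 := bd_den_neq0 t0.
rewrite /bd_one -/(E t); apply: (mulIf (expf_neq0 2 L0)).
by rewrite /bd_den -/(E t) in L0 *; field.
Qed.

Lemma is_derive_bd_extinct (t : R) : 0 <= t -> is_derive t 1 bd_extinct (mu * bd_one t).
Proof.
move=> t0; apply: is_derive_eq (is_derive_mulr (d1E mu t) (dVden t0)) _.
have L0 := bd_den_neq0 t0.
by rewrite /bd_one /bd_den -/(E t) in L0 *; field.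
Qed.

Lemma is_derive_bd_one (t : R) : 0 <= t ->
  is_derive t 1 bd_one (bd_one t * (2 * lambda * bd_extinct t - (lambda + mu))).
Proof.
move=> t0; have dL := dVden t0.
have d1 := is_derive_mulr (is_derive_cmulr ((lambda - mu) ^+ 2) (dE t)) (is_derive_exprn 2 dL).
rewrite (_ : bd_one = fun y : R => (lambda - mu) ^+ 2 * E y * (bd_den y)^-1 ^+ 2); last first.
  by apply/funext => y; rewrite /bd_one exprVn.
apply: is_derive_eq d1 _.
have L0 := bd_den_neq0 t0.
by rewrite /bd_extinct /bd_den -/(E t) in L0 *; field.
Qed.

Definition pop_conv (n : nat) (t : R) : R :=
  \sum_(j < n.+1) pop_law j t * pop_law (n - j) t.

Definition recon_conv (c : R) (n : nat) (t : R) : R :=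
  \sum_(j < n.+1) (recon_law c j t * pop_law (n - j) t +
                   pop_law j t * recon_law c (n - j) t).

(** The laws are geometric only from index 1 on, so the two terms of a convolution involving index 0
    are set apart. *)
Let sum_ends (F : nat -> R) (m : nat) :
  \sum_(j < m.+2) F j = F 0 + F m.+1 + \sum_(i < m) F i.+1.
Proof.
rewrite -(big_mkord xpredT F) big_nat_recl// big_nat_recr//= big_mkord.
by rewrite [X in _ + X]addrC addrA.
Qed.

(** The m inner terms are all equal, the exponents of the ratio adding up to m - 1. For m = 0 the
    truncated exponent is multiplied by 0. *)
Lemma pop_convS m t : pop_conv m.+1 t =
  2 * bd_extinct t * pop_law m.+1 t + m%:R * bd_one t ^+ 2 * bd_ratio t ^+ m.-1.
Proof.
rewrite /pop_conv (sum_ends (fun j => pop_law j t * pop_law (m.+1 - j) t)) subn0 subnn.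
congr (_ + _); first by rewrite /=; ring.
rewrite (eq_bigr (fun=> bd_one t ^+ 2 * bd_ratio t ^+ m.-1)) => [|i _].
  by rewrite sumr_const card_ord -mulrA mulr_natl.
case: m i => [|m] [i im] //=; rewrite subSS subSn//=.
have -> : bd_ratio t ^+ m = bd_ratio t ^+ i * bd_ratio t ^+ (m - i).
  by rewrite -exprD subnKC.
by ring.
Qed.

(** The Leibniz rule for x^i x^r, with truncated predecessors as exponents. It makes the excess
    terms of a convolution independent of i. *)
Let excess_weight (x : R) (i r : nat) :
  i%:R * x ^+ i.-1 * x ^+ r + r%:R * x ^+ i * x ^+ r.-1 = (i + r)%:R * x ^+ (i + r).-1.
Proof.
case: i => [|i]; first by rewrite mulr0n !mul0r add0r add0n expr0 mulr1.
case: r => [|r]; first by rewrite mulr0n !mul0r !addn0 expr0 mulr1 addr0.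
rewrite natrD [RHS]mulrDl -!mulrA -!exprD /= -addSnnS.
by rewrite addSn.
Qed.

Lemma recon_convS c m t : recon_conv c m.+1 t = pop_conv m.+1 t +
  2 * bd_extinct t * recon_excess c m.+1 t +
  m%:R * bd_one t ^+ 2 * bd_ratio t ^+ m.-1 +
  m%:R * m.-1%:R * bd_one t ^+ 2 * (bd_ratio t - c) * bd_ratio t ^+ m.-2.
Proof.
pose F j := recon_law c j t * pop_law (m.+1 - j) t + pop_law j t * recon_law c (m.+1 - j) t.
pose G j := pop_law j t * pop_law (m.+1 - j) t.
rewrite /recon_conv /pop_conv (sum_ends F) (sum_ends G) /F /G subn0 subnn /recon_law.
set A := \sum_(i < m) _; set B := \sum_(i < m) _.
suff -> : A = B + m%:R * (bd_one t ^+ 2 * bd_ratio t ^+ m.-1 +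
    m.-1%:R * bd_one t ^+ 2 * (bd_ratio t - c) * bd_ratio t ^+ m.-2).
  by rewrite /=; ring.
rewrite {}/A {}/B mulr_natl -[X in _ *+ X](card_ord m) -sumr_const -big_split /=.
apply: eq_bigr => -[i im] _ /=; case: m im {F G} => // m im.
rewrite subSS subSn//=.
have := excess_weight (bd_ratio t) i (m - i); rewrite subnKC//.
rewrite [m.+1.-2]/= => H.
transitivity (bd_one t * bd_ratio t ^+ i * (bd_one t * bd_ratio t ^+ (m - i)) * 2 +
  bd_one t ^+ 2 * (bd_ratio t - c) * (i%:R * bd_ratio t ^+ i.-1 * bd_ratio t ^+ (m - i) + (m - i)%:R * bd_ratio t ^+ i * bd_ratio t ^+ (m - i).-1)).
  by ring.
have -> : bd_ratio t ^+ m = bd_ratio t ^+ i * bd_ratio t ^+ (m - i).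
  by rewrite -exprD subnKC.
by rewrite H; ring.
Qed.

(** The backward Kolmogorov equation, which is the differential form of the first renewal
    equation. *)
Lemma is_derive_pop_law n (t : R) : 0 <= t ->
  is_derive t 1 (pop_law n)
    (- (lambda + mu) * pop_law n t + lambda * pop_conv n t + (n == 0)%:R * mu).
Proof.
move=> t0; have dq := is_derive_bd_one t0; have de := is_derive_bd_ratio t0.
case: n => [|m].
  apply: is_derive_eq (is_derive_bd_extinct t0) _.
  rewrite /pop_conv big_ord1 /= bd_oneE// bd_extinctE; field.
  by rewrite gt_eqF.
apply: is_derive_eq (is_derive_mulr dq (is_derive_exprn m de)) _.
by rewrite pop_convS /=; ring.
Qed.

(** The differential form of the second renewal equation for the excess over the population law.
    Here c is constant because t - s is kept fixed. *)
Lemma is_derive_recon_excess c m (t : R) : 0 <= t ->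
  is_derive t 1 (recon_excess c m.+1)
    (- (lambda + mu) * recon_excess c m.+1 t +
     lambda * (recon_conv c m.+1 t - pop_conv m.+1 t)).
Proof.
move=> t0; have dq := is_derive_bd_one t0; have de := is_derive_bd_ratio t0.
have dec : is_derive t 1 (fun y : R => bd_ratio y - c) (lambda * bd_one t).
  by apply: is_derive_eq (is_deriveB de (is_derive_cst c t 1)) _; rewrite subr0.
apply: is_derive_eq (is_derive_mulr (is_derive_mulr (is_derive_cmulr m%:R dq) dec)
  (is_derive_exprn m.-1 de)) _.
rewrite recon_convS pop_convS /=.
case: m => [|m]; first by rewrite !mul0r; ring.
by rewrite /=; ring.
Qed.

End closed_forms.

Section law_renewal.
Context {R : realType}.
Variables lambda mu : R.
Hypothesis lambda_gt0 : 0 < lambda.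
Hypothesis mu_ge0 : 0 <= mu.
Hypothesis lambda_neq_mu : lambda != mu.

Let leb := @lebesgue_measure R.
Let k (x : R) : R := lambda * expR (- (lambda + mu) * x).
Let law := pop_law lambda mu.

Let derivable_law n (t : R) : 0 <= t -> derivable (law n) t 1.
Proof. by move=> t0; have [] := is_derive_pop_law lambda_gt0 mu_ge0 lambda_neq_mu n t0. Qed.

Let derivable_recon_law c n (t : R) : 0 <= t -> derivable (recon_law lambda mu c n) t 1.
Proof.
move=> t0; case: n => [|m].
  rewrite (_ : recon_law _ _ _ _ = cst 0); first exact: derivable_cst.
  by apply/funext => y; rewrite /recon_law /= subrr.
apply: derivableD; first exact: derivable_law.
by have [] := is_derive_recon_excess lambda_gt0 mu_ge0 lambda_neq_mu c m t0.
Qed.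

Lemma derivable_pop_conv n (t : R) : 0 <= t -> derivable (pop_conv lambda mu n) t 1.
Proof.
move=> t0; rewrite (_ : pop_conv _ _ _ = \sum_(j < n.+1) (law j * law (n - j)%N)).
  by apply: derivable_sum => j; apply: derivableM; exact: derivable_law.
by apply/funext => y; rewrite fct_sumE.
Qed.

Lemma derivable_recon_conv c n (t : R) : 0 <= t ->
  derivable (recon_conv lambda mu c n) t 1.
Proof.
move=> t0; rewrite (_ : recon_conv _ _ _ _ = \sum_(j < n.+1)
    (recon_law lambda mu c j * law (n - j)%N + law j * recon_law lambda mu c (n - j)%N)).
  apply: derivable_sum => j; have dp i := @derivable_law i _ t0.
  have dr i := @derivable_recon_law c i _ t0.
  exact: (derivableD (derivableM (dr j) (dp (n - j)%N)) (derivableM (dp j) (dr (n - j)%N))).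
by apply/funext => y; rewrite fct_sumE.
Qed.

Let derivable_weighted (f : R -> R) (t x : R) : derivable f (t - x) 1 ->
  derivable (fun y => k y * f (t - y)) x 1.
Proof.
move=> df; have /derivableP dft := df.
have dk := is_derive_cmulr lambda (is_derive_expRM (- (lambda + mu)) x).
by have [] := is_derive_mulr dk (is_derive_subl dft).
Qed.

(** The integrating factor: when the derivative a contains the term -(lambda + mu) f, that term
    cancels and only the source is left. *)
Let is_derive_weighted (f : R -> R) (t x a : R) : is_derive (t - x) 1 f a ->
  is_derive x 1 (fun y => - expR (- (lambda + mu) * y) * f (t - y))
    (expR (- (lambda + mu) * x) * ((lambda + mu) * f (t - x) + a)).
Proof.
move=> df.
have dE := is_derive_expRM (- (lambda + mu)) x.
have dN : is_derive x 1 (fun y => - expR (- (lambda + mu) * y))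
    ((lambda + mu) * expR (- (lambda + mu) * x)).
  by apply: is_derive_eq (is_deriveN dE) _; rewrite mulNr opprK.
apply: is_derive_eq (is_derive_mulr dN (is_derive_subl df)) _.
by ring.
Qed.

Lemma integrable_pop_conv n s t : 0 <= s <= t ->
  leb.-integrable `]0, s] (EFin \o (fun x => k x * pop_conv lambda mu n (t - x))).
Proof.
move=> /andP[s0 st]; apply: integrable_derivable => x /andP[x0 xs].
apply: derivable_weighted; apply: derivable_pop_conv.
by rewrite subr_ge0 (le_trans xs).
Qed.

Lemma integrable_recon_conv c n s t : 0 <= s <= t ->
  leb.-integrable `]0, s] (EFin \o (fun x => k x * recon_conv lambda mu c n (t - x))).
Proof.
move=> /andP[s0 st]; apply: integrable_derivable => x /andP[x0 xs].
apply: derivable_weighted; apply: derivable_recon_conv.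
by rewrite subr_ge0 (le_trans xs).
Qed.

Lemma pop_law_renewal n s : 0 <= s ->
  law n s = \int[leb]_(x in `]0, s]) (k x * pop_conv lambda mu n (s - x)) +
    (n == 1)%:R * expR (- (lambda + mu) * s) +
    (n == 0)%:R * (1 - expR (- (lambda + mu) * s) - \int[leb]_(x in `]0, s]) k x).
Proof.
move=> s0.
have ik := integrable_splitting_density lambda_gt0 mu_ge0 s.
(* Subtracting b turns the source mu b of the backward equation into -lambda b, so that everything
   is expressed with the kernel [k]. *)
pose b : R := (n == 0)%:R.
have dF x : 0 <= x <= s -> is_derive x 1
    (fun y => - expR (- (lambda + mu) * y) * (fun t => law n t - b) (s - y))
    (k x * pop_conv lambda mu n (s - x) - b * k x).
  move=> /andP[x0 xs]; have sx0 : 0 <= s - x by rewrite subr_ge0.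
  have dl : is_derive (s - x) 1 (fun t : R => law n t - b)
     (- (lambda + mu) * law n (s - x) + lambda * pop_conv lambda mu n (s - x) + b * mu).
    have dp := is_derive_pop_law lambda_gt0 mu_ge0 lambda_neq_mu n sx0.
    have := is_deriveB dp (is_derive_cst b (s - x) 1).
    by rewrite subr0.
  by apply: is_derive_eq (is_derive_weighted dl) _; rewrite /k; ring.
have dk (x : R) := is_derive_cmulr b (is_derive_cmulr lambda (is_derive_expRM (- (lambda + mu)) x)).
have dcv x : 0 <= x <= s -> derivable (fun x => k x * pop_conv lambda mu n (s - x)) x 1.
  move=> /andP[x0 xs]; apply: derivable_weighted; apply: derivable_pop_conv.
  by rewrite subr_ge0.
have dfx x : 0 <= x <= s ->
    derivable (fun x => k x * pop_conv lambda mu n (s - x) - b * k x) x 1.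
  by move=> xs; apply: derivableB; [exact: dcv|have [] := dk x].
have := Rintegral_derive s0 dF dfx; rewrite RintegralB//; last 2 first.
- by apply: integrable_pop_conv; rewrite s0 lexx.
- by apply: integrable_derivable => x _; have [] := dk x.
rewrite RintegralZl// subrr subr0 mulr0 expR0 [law n 0]pop_law0// => H.
have {}H : \int[leb]_(x in `]0, s]) (k x * pop_conv lambda mu n (s - x)) =
  b * \int[leb]_(x in `]0, s]) k x +
  (- expR (- (lambda + mu) * s) * ((n == 1)%:R - b) - - 1 * (law n s - b)).
  by rewrite -H; ring.
rewrite [in RHS]H /b; ring.
Qed.

Lemma recon_law_renewal m s t : 0 <= s <= t ->
  recon_law lambda mu (bd_ratio lambda mu (t - s)) m.+1 t = law m.+1 t +
    \int[leb]_(x in `]0, s])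
      (k x * recon_conv lambda mu (bd_ratio lambda mu (t - s)) m.+1 (t - x)) -
    \int[leb]_(x in `]0, s]) (k x * pop_conv lambda mu m.+1 (t - x)).
Proof.
move=> /andP[s0 st]; set c := bd_ratio _ _ _.
have tx0 x : 0 <= x <= s -> 0 <= t - x.
  by move=> /andP[_ xs]; rewrite subr_ge0 (le_trans xs).
pose f x := k x * recon_conv lambda mu c m.+1 (t - x) - k x * pop_conv lambda mu m.+1 (t - x).
have dF x : 0 <= x <= s -> is_derive x 1
    (fun y => - expR (- (lambda + mu) * y) * recon_excess lambda mu c m.+1 (t - y)) (f x).
  move=> /tx0 tx.
  have de := is_derive_recon_excess lambda_gt0 mu_ge0 lambda_neq_mu c m tx.
  by apply: is_derive_eq (is_derive_weighted de) _; rewrite /f /k; ring.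
have df x : 0 <= x <= s -> derivable f x 1.
  move=> /tx0 tx; apply: derivableB; apply: derivable_weighted.
    exact: derivable_recon_conv.
  exact: derivable_pop_conv.
have := Rintegral_derive s0 dF df.
rewrite RintegralB//; last 2 first.
- by apply: integrable_recon_conv; rewrite s0.
- by apply: integrable_pop_conv; rewrite s0.
(* The boundary term fixes the value of c: at s = 0 the only lineage is the root, so M = 1 on N > 0
   and the excess must vanish at time t - s. *)
have -> : recon_excess lambda mu c m.+1 (t - s) = 0.
  by rewrite /= -/c subrr mulr0 mul0r.
rewrite /recon_law subr0 !mulr0 expR0 -addrA => ->.
by rewrite /law; ring.
Qed.

End law_renewal.

(** * Laws of the population and of the reconstructed tree *)

Section population_law.
Context {d : measure_display} {T : measurableType d} {R : realType}.
Variables (P : probability T R) (lambda mu : R).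
Hypothesis lambda_gt0 : 0 < lambda.
Hypothesis mu_ge0 : 0 <= mu.
Hypothesis lambda_neq_mu : lambda != mu.
Implicit Types S D : lineage -> {RV P >-> \bar R}.

Let leb := @lebesgue_measure R.
Let k (x : R) : R := lambda * expR (- (lambda + mu) * x).
Let law := pop_law lambda mu.

Let k_bounds x : 0 < x -> 0 <= k x <= lambda.
Proof.
move=> x0; have k0 : 0 <= k x by rewrite mulr_ge0 ?expR_ge0// ltW.
by rewrite k0 -[leLHS]ger0_norm// (splitting_density_bounded lambda_gt0 mu_ge0).
Qed.

Let norm_sum_le (n : nat) (F : 'I_n -> R) (M : R) :
  (forall i, `|F i| <= M) -> `|\sum_(i < n) F i| <= n%:R * M.
Proof.
move=> FM; apply: le_trans (ler_norm_sum _ _ _) _.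
rewrite mulr_natl -[X in _ *+ X](card_ord n) -sumr_const.
by apply: ler_sum => i _; exact: FM.
Qed.

(** At most n + 1 terms, each with error 2 M, under a kernel bounded by lambda give 2 lambda (n + 1)
    M; dividing by this rate leaves M / 2. *)
Let rate n := 4 * lambda * n.+1%:R.

Let rate_gt0 n : 0 < rate n. Proof. by rewrite !mulr_gt0. Qed.

(* [M] is halved by one step of the iteration. *)
Let contraction_step (n j : nat) (s M : R) (F G : 'I_j.+1 -> R -> R) :
  (j <= n)%N -> 0 <= s -> 0 <= M ->
  leb.-integrable `]0, s] (EFin \o (fun x => k x * \sum_(i < j.+1) F i x)) ->
  leb.-integrable `]0, s] (EFin \o (fun x => k x * \sum_(i < j.+1) G i x)) ->
  (forall i x, 0 < x <= s -> `|F i x - G i x| <= 2 * (M * expR (rate n * (s - x)))) ->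
  `|\int[leb]_(x in `]0, s]) (k x * \sum_(i < j.+1) F i x) -
    \int[leb]_(x in `]0, s]) (k x * \sum_(i < j.+1) G i x)| <= M / 2 * expR (rate n * s).
Proof.
move=> jn s0 M0 iF iG FG.
have -> : M / 2 = (lambda * n.+1%:R * 2 * M) / rate n.
  transitivity (rate n * (M / 2) / rate n); last by congr (_ / _); rewrite /rate; field.
  by rewrite mulrAC divff ?mul1r// gt_eqF.
apply: Volterra_contraction => //.
  by rewrite !mulr_ge0// ltW.
move=> x /andP[x0 xs]; rewrite -mulrBr -sumrB normrM.
have /andP[k0 k1] := k_bounds x0.
rewrite (ger0_norm k0); move: (k x) k0 k1 => kx k0 k1.
have {}FG i : `|F i x - G i x| <= 2 * (M * expR (rate n * (s - x))) by apply: FG; rewrite x0.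
move: (expR _) (expR_ge0 (rate n * (s - x))) FG => e e0 FG.
rewrite -!mulrA; apply: ler_pM => //.
apply: le_trans (norm_sum_le FG) _.
by rewrite ler_wpM2r ?ler_nat// !mulr_ge0.
Qed.

Lemma pop_probP S D n t : birth_death_clocks lambda mu S D -> 0 <= t ->
  pop_prob S D n t = law n t.
Proof.
(* All j <= n are treated at once, because the convolution at n involves each of them. *)
suff H i : forall S D, birth_death_clocks lambda mu S D -> forall j s, (j <= n)%N -> 0 <= s ->
    `|pop_prob S D j s - law j s| <= 1 / 2 ^+ i * expR (rate n * s).
  move=> SD t0; apply/eqP; rewrite -subr_eq0; apply/eqP.
  apply: (@eq0_le_halves _ _ (expR (rate n * t))) => i.
  by have := H i S D SD n t (leqnn n) t0; rewrite mul1r mulrC.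
elim: i => [|i IH] {}S {}D SD j s jn s0.
  have := pop_law_ge0 lambda_gt0 mu_ge0 lambda_neq_mu j s0.
  have := pop_law_le1 lambda_gt0 mu_ge0 lambda_neq_mu j s0.
  have := pop_prob_ge0 S D j s; have := pop_prob_le1 S D j s.
  rewrite -/law => p1 p0 q1 q0.
  apply: (@le_trans _ _ 1); first by rewrite ler_norml; lra.
  by rewrite expr0 divr1 mul1r -expR0 ler_expR mulr_ge0// ltW.
rewrite (renewal_pop lambda_gt0 mu_ge0 SD)// /law pop_law_renewal//.
have cancel (x y b c : R) : x + b + c - (y + b + c) = x - y by ring.
rewrite cancel.
rewrite (_ : 1 / 2 ^+ i.+1 = (1 / 2 ^+ i) / 2); last by rewrite exprS; field.
apply: contraction_step => //.
- exact: (integrable_conv_pop _ _ lambda_gt0 mu_ge0).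
- by apply: integrable_pop_conv; rewrite // s0 lexx.
move=> l x /andP[x0 xs].
have sx0 : 0 <= s - x by rewrite subr_ge0.
have lj : (l <= n)%N by rewrite (leq_trans _ jn)// -ltnS.
have jln : (j - l <= n)%N by rewrite (leq_trans (leq_subr _ _)).
have := IH _ _ (birth_death_clocks_subtree false SD) _ _ lj sx0.
have := IH _ _ (birth_death_clocks_subtree true SD) _ _ jln sx0.
have := pop_prob_ge0 (subtree true S) (subtree true D) (j - l) (s - x).
have := pop_prob_le1 (subtree true S) (subtree true D) (j - l) (s - x).
have := pop_law_ge0 lambda_gt0 mu_ge0 lambda_neq_mu l sx0.
have := pop_law_le1 lambda_gt0 mu_ge0 lambda_neq_mu l sx0.
rewrite -/law; set a := pop_prob _ _ l _; set b := pop_prob _ _ (j - l) _.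
set p := law l _; set q := law (j - l)%N _.
move=> p1 p0 b1 b0 bq ap.
(* Since b and p lie in [0, 1], the product costs one error from each subtree, whence the factor 2
   in [contraction_step]. *)
rewrite (_ : a * b - p * q = (a - p) * b + p * (b - q)); last by ring.
apply: le_trans (ler_normD _ _) _; rewrite mulr_natl mulr2n; apply: lerD.
  by rewrite normrM (ger0_norm b0); apply: le_trans ap; rewrite ler_piMr.
by rewrite normrM (ger0_norm p0); apply: le_trans bq; rewrite ler_piMl.
Qed.

Lemma pop_reconP S D n s t : birth_death_clocks lambda mu S D -> 0 <= s <= t ->
  pop_recon S D n s t = recon_law lambda mu (bd_ratio lambda mu (t - s)) n t.
Proof.
set c := bd_ratio _ _ _ => SD /andP[s0 st].
have ts0 : 0 <= t - s by rewrite subr_ge0.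
have c01 : 0 <= c <= 1.
  by rewrite (bd_ratio_ge0 lambda_gt0 mu_ge0)// (bd_ratio_le1 lambda_gt0 mu_ge0).
(* The difference v - u is the invariant: passing to a subtree shifts both times by the split time,
   so c stays the same along the iteration. *)
suff H i : forall S D, birth_death_clocks lambda mu S D -> forall j u v, (j <= n)%N ->
    0 <= u -> v - u = t - s ->
    `|pop_recon S D j u v - recon_law lambda mu c j v| <=
    (2 * n%:R) / 2 ^+ i * expR (rate n * u).
  apply/eqP; rewrite -subr_eq0; apply/eqP.
  apply: (@eq0_le_halves _ _ (2 * n%:R * expR (rate n * s))) => i.
  by have := H i S D SD n s t (leqnn n) s0 erefl; rewrite mulrAC.
elim: i {S D SD} => [|i IH] S D SD j u v jn u0 uv; have v0 : 0 <= v by lra.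
  have := recon_law_bound lambda_gt0 mu_ge0 lambda_neq_mu j c01 v0.
  have := pop_recon_ge0 S D j u v; have := pop_recon_le SD j u v.
  move=> r1 r0 a1; rewrite expr0 divr1.
  apply: (@le_trans _ _ (2 * n%:R)).
    have jnR : j%:R <= n%:R :> R by rewrite ler_nat.
    apply: le_trans (ler_normB _ _) _; rewrite (ger0_norm r0); lra.
  by rewrite ler_peMr// ?mulr_ge0// -expR0 ler_expR mulr_ge0// ltW.
(* Index 0 is outside [renewal_recon]; there both quantities are 0. *)
case: j jn => [|m] jn.
  have := pop_recon_ge0 S D 0 u v; have := pop_recon_le SD 0 u v.
  move=> r1 r0; rewrite /recon_law /= subrr subr0 ger0_norm//.
  by apply: le_trans r1 _; rewrite !mulr_ge0 ?expR_ge0// invr_ge0 exprn_ge0.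
have uv0 : 0 <= u <= v by rewrite u0; lra.
rewrite (renewal_recon lambda_gt0 mu_ge0 SD)// /c -uv recon_law_renewal// uv -/c.
(* With the population law known, the subtracted convolutions coincide and cancel, and only the
   terms linear in the unknown are compared. *)
have convE : \int[leb]_(x in `]0, u]) (k x * \sum_(l < m.+2)
      pop_prob (subtree false S) (subtree false D) l (v - x) *
      pop_prob (subtree true S) (subtree true D) (m.+1 - l) (v - x)) =
    \int[leb]_(x in `]0, u]) (k x * pop_conv lambda mu m.+1 (v - x)).
  apply: eq_Rintegral => x /set_mem/=; rewrite in_itv/= => /andP[x0 xu].
  have vx0 : 0 <= v - x by lra.
  congr (_ * _); apply: eq_bigr => l _.
  by rewrite !pop_probP//; exact: birth_death_clocks_subtree.
rewrite convE pop_probP//.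
have cancel (x y a b : R) : a + x - b - (a + y - b) = x - y by ring.
rewrite cancel (_ : 2 * n%:R / 2 ^+ i.+1 = (2 * n%:R / 2 ^+ i) / 2); last first.
  by rewrite exprS; field; rewrite expf_neq0.
apply: contraction_step => //.
- exact: (integrable_conv_recon lambda_gt0 mu_ge0 SD).
- exact: integrable_recon_conv.
move=> l x /andP[x0 xu].
have ux0 : 0 <= u - x by rewrite subr_ge0.
have vx0 : 0 <= v - x by lra.
have vux : v - x - (u - x) = t - s by rewrite -uv; ring.
have lj : (l <= n)%N by rewrite (leq_trans _ jn)// -ltnS.
have jln : (m.+1 - l <= n)%N by rewrite (leq_trans (leq_subr _ _)).
have := IH _ _ (birth_death_clocks_subtree false SD) _ _ _ lj ux0 vux.
have := IH _ _ (birth_death_clocks_subtree true SD) _ _ _ jln ux0 vux.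
rewrite !pop_probP//; try exact: birth_death_clocks_subtree.
have := pop_law_ge0 lambda_gt0 mu_ge0 lambda_neq_mu l vx0.
have := pop_law_le1 lambda_gt0 mu_ge0 lambda_neq_mu l vx0.
have := pop_law_ge0 lambda_gt0 mu_ge0 lambda_neq_mu (m.+1 - l) vx0.
have := pop_law_le1 lambda_gt0 mu_ge0 lambda_neq_mu (m.+1 - l) vx0.
rewrite -/law; set a := pop_recon _ _ l _ _; set b := pop_recon _ _ (m.+1 - l) _ _.
set a' := recon_law _ _ _ l _; set b' := recon_law _ _ _ (m.+1 - l) _.
set p := law l _; set q := law (m.+1 - l)%N _.
move=> q1 q0 p1 p0 bb aa.
rewrite (_ : a * q + p * b - (a' * q + p * b') = (a - a') * q + p * (b - b')); last by ring.
apply: le_trans (ler_normD _ _) _; rewrite mulr_natl mulr2n; apply: lerD.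
  by rewrite normrM (ger0_norm q0); apply: le_trans aa; rewrite ler_piMr.
by rewrite normrM (ger0_norm p0); apply: le_trans bb; rewrite ler_piMl.
Qed.

End population_law.

(** * Algebra of the conditional expectation *)

Lemma add1_f_reconstructed {R : realType} (lambda mu sigma t : R) :
  0 < lambda -> 0 <= mu -> lambda != mu -> 0 < t -> 0 <= sigma -> sigma < 1 ->
  1 + f_reconstructed sigma t (mu / lambda) (lambda - mu) =
  bd_ratio lambda mu t / bd_ratio lambda mu (t - sigma * t).
Proof.
move=> l0 m0 lm t0 s0 s1; pose tau := t - sigma * t.
have tau0 : 0 < tau by rewrite /tau -[X in X - _]mul1r -mulrBl mulr_gt0// subr_gt0.
have := bd_den_neq0 l0 m0 lm (ltW t0); have := bd_den_neq0 l0 m0 lm (ltW tau0).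
have := bd_ratio_gt0 l0 m0 lm tau0.
rewrite /f_reconstructed -/tau /bd_ratio /bd_den.
(* In terms of x and y, with e^(-(lambda - mu) t) = x y, the claim is an identity of rational
   functions. *)
pose x := expR (- sigma * (lambda - mu) * t); pose y := expR (- (lambda - mu) * tau).
have -> : expR (- (lambda - mu) * t) = x * y.
  by rewrite -expRD; congr expR; rewrite /tau; ring.
have -> : - (1 - sigma) * (lambda - mu) * t = - (lambda - mu) * tau by rewrite /tau; ring.
rewrite -/x -/y => r0 ty tx.
have y1 : 1 - y != 0.
  by apply: contraTneq r0 => ->; rewrite mulr0 mul0r ltxx.
have l_neq0 : lambda != 0 by rewrite gt_eqF.
have -> : 1 - mu / lambda * (x * y) = (lambda - mu * (x * y)) / lambda by field.
by field; rewrite ?tx ?ty ?y1 ?l_neq0.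
Qed.

Theorem corollary2p3 (R : realType) (d : measure_display)
    (T : measurableType d) (P : probability T R) (lambda mu : R)
    (S D : lineage -> {RV P >-> \bar R}) (t sigma : R) (n : nat)
    (lambda_gt0 : 0 < lambda) (mu_ge0 : 0 <= mu) (lambda_neq_mu : lambda != mu)
    (SD_clocks : birth_death_clocks lambda mu S D)
    (t_gt0 : 0 < t) (sigma_ge0 : 0 <= sigma) (sigma_lt1 : sigma < 1)
    (n_ge1 : (1 <= n)%N) :
  let rho := mu / lambda in
  let delta := lambda - mu in
  let M (s : R) : T -> \bar R := num_reconstructed S D s t in
  let f := f_reconstructed sigma t rho delta in
  cond_expectation P (M sigma) [set w | M 1 w = n%:R%:E] =
    ((1 + n%:R * f) / (1 + f))%:E.
Proof.
move=> rho delta M f.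
have mS u : measurable_fun setT (S u) by exact: measurable_funPT.
have mD u : measurable_fun setT (D u) by exact: measurable_funPT.
have t0 := ltW t_gt0.
have st : 0 <= sigma * t <= t by rewrite mulr_ge0//= ler_piMl// ltW.
pose A := [set w | recon S D t t w = n%:R%:E].
have mA : measurable A.
  by rewrite -[X in measurable X]setTI; apply: measurable_eqe => //; exact: measurable_recon.
have AE w : \1_A w = pop_eq S D n t w.
  rewrite indicE /pop_eq; congr (nat_of_bool _)%:R.
  by apply/idP/eqP => [/set_mem//|wA]; exact: mem_set.
have -> : [set w | M 1 w = n%:R%:E] = A by rewrite /M num_reconstructed1.
rewrite /cond_expectation.
have -> : fine (P A) = pop_law lambda mu n t.
  rewrite -(pop_probP lambda_gt0 mu_ge0 lambda_neq_mu n SD_clocks t0).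
  congr fine; transitivity (\int[P]_w (\1_A w)%:E)%E.
    by rewrite integral_indic// setIT.
  by apply: eq_integral => w _; rewrite AE.
have -> : (\int[P]_(w in A) M sigma w =
    (recon_law lambda mu (bd_ratio lambda mu (t - sigma * t)) n t)%:E)%E.
  rewrite -(pop_reconP lambda_gt0 mu_ge0 lambda_neq_mu n SD_clocks st).
  rewrite -(pop_reconE SD_clocks) integral_mkcond; apply: eq_integral => w _.
  rewrite patchE -AE indicE; case: ifP => _; by rewrite ?mule1 ?mule0.
rewrite -EFinM; congr EFin.
have f1 : 1 + f = bd_ratio lambda mu t / bd_ratio lambda mu (t - sigma * t).
  exact: add1_f_reconstructed.
have tau0 : 0 < t - sigma * t by rewrite -[X in X - _]mul1r -mulrBl mulr_gt0// subr_gt0.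
(* These positivity facts say that N_t = n has positive probability and that 1 + f can be
   inverted. *)
have := bd_ratio_gt0 lambda_gt0 mu_ge0 lambda_neq_mu tau0.
have := bd_ratio_gt0 lambda_gt0 mu_ge0 lambda_neq_mu t_gt0.
have := bd_one_gt0 lambda_gt0 mu_ge0 lambda_neq_mu t0.
have -> : f = bd_ratio lambda mu t / bd_ratio lambda mu (t - sigma * t) - 1.
  by rewrite -f1; ring.
clear A mA AE; move: n_ge1; case: n => // m _; rewrite /recon_law /=.
move: (bd_one lambda mu t) (bd_ratio lambda mu t) (bd_ratio lambda mu (t - sigma * t)).
move=> q e c q0 e0 c0.
have [qN eN cN] : [/\ q != 0, e != 0 & c != 0] by rewrite !gt_eqF.
rewrite [1 + (_ - 1)]addrC subrK.
(* Both sides are 1 + m (1 - c / e) for n = m + 1. The case m = 0 is apart because of the truncated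
   exponent m - 1. *)
case: m => [|m] /=; first by field; rewrite qN eN cN.
have emN : e ^+ m != 0 by exact: expf_neq0.
by rewrite exprS; field; rewrite qN eN cN emN.
Qed.
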